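(* Let $S$ and $E$ be finite-dimensional quantum systems of dimensions $d_S,d_E$, let $\sigma=\sigma_S\otimes\sigma_E$ and $\sigma'=\sigma'_S\otimes\sigma'_E$ be full-rank product states on $SE$, let $\mathcal E$ be a quantum channel on states of $SE$ with $\mathcal E(\sigma)=\sigma'$, and let $\rho_E$ be a full-rank state on $E$. Define the channel $\mathcal C(\cdot)=\mathrm{Tr}_E[\mathcal E(\cdot\otimes\rho_E)]$ on $S$. Let $\rho_S$ be a state on $S$ such that $\rho_S\otimes\rho_E$ commutes with $\sigma$ and $\mathcal E(\rho_S\otimes\rho_E)$ commutes with $\sigma'$. Put $\rho'_S=\mathcal C(\rho_S)$, $\rho'_E=\mathrm{Tr}_S[\mathcal E(\rho_S\otimes\rho_E)]$, $\Delta S_S=S(\rho_S\|\sigma_S)-S(\rho'_S\|\sigma'_S)$, $\Delta S_E=S(\rho_E\|\sigma_E)-S(\rho'_E\|\sigma'_E)$, $\Delta V_S=V(\rho_S\|\sigma_S)-V(\rho'_S\|\sigma'_S)$, $\Delta V_E=V(\rho_E\|\sigma_E)-V(\rho'_E\|\sigma'_E)$, and $I_{S:E}=S(\mathcal E(\rho_S\otimes\rho_E)\|\rho'_S\otimes\rho'_E)$. Then $$\Delta S_S+\Delta S_E\ge\frac{\Delta V_S+\Delta V_E-K\,f(I_{S:E})}{2\sqrt{M_{s_{\min}}(\rho_S\otimes\rho_E\|\sigma)}},$$ where $K=\sqrt{2\ln 2}\left(12+\log^2(s_{\min})+8\log^2(d_Sd_E)\right)$, $f(x)=\max\{\sqrt[4]{x},x^2\}$,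 and $s_{\min}$ is the smallest eigenvalue of $\sigma$.
   Context: Logs are base 2 unless written $\ln$. $S(\rho\|\sigma)=\mathrm{Tr}(\rho(\log\rho-\log\sigma))$, $V(\rho\|\sigma)=\mathrm{Tr}(\rho(\log\rho-\log\sigma)^2)-S(\rho\|\sigma)^2$, and $M_x(\rho\|\sigma)=V(\rho\|\sigma)+\left(\frac1{\ln2}-\log x-S(\rho\|\sigma)\right)^2$. *)

(* Defs.v *)
From HB Require Import structures.
From mathcomp Require Import all_boot all_order all_algebra.
From mathcomp Require Import boolp reals exp.
From mathcomp Require Import complex mxtens.
Set Implicit Arguments. Unset Strict Implicit. Unset Printing Implicit Defensive.
Import Order.TTheory GRing.Theory Num.Theory.
Local Open Scope ring_scope.
Local Open Scope complex_scope.

Section QDefs.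
Variable R : realType.
Local Notation C := R[i].

Definition adjmx m n (A : 'M[C]_(m, n)) : 'M[C]_(n, m) := (map_mx conjc A)^T.

Definition psdmx n (A : 'M[C]_n) : Prop :=
  forall v : 'cV[C]_n, 0 <= (adjmx v *m A *m v) 0 0.

Definition state n (A : 'M[C]_n) : Prop := psdmx A /\ \tr A = 1.

Definition full_rank n (A : 'M[C]_n) : Prop := \rank A = n.

Definition unitarymx n (U : 'M[C]_n) : Prop := adjmx U *m U = 1%:M.

Definition spectral_decomp n (A : 'M[C]_n) (UD : 'M[C]_n * 'rV[R]_n) : Prop :=
  unitarymx UD.1 /\
  A = UD.1 *m diag_mx (map_mx (fun x : R => x%:C) UD.2) *m adjmx UD.1.

Definition mxfun (f : R -> R) n (A : 'M[C]_n) : 'M[C]_n :=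
  match pselect (exists UD, spectral_decomp A UD) with
  | left H =>
      let UD := proj1_sig (constructive_indefinite_description H) in
      UD.1 *m diag_mx (map_mx (fun x : R => (f x)%:C) UD.2) *m adjmx UD.1
  | right _ => 0
  end.

Definition log2 (x : R) : R := ln x / ln 2.

Definition mxlog2 n (A : 'M[C]_n) : 'M[C]_n := mxfun log2 A.

Definition relent n (rho sigma : 'M[C]_n) : R :=
  complex.Re (\tr (rho *m (mxlog2 rho - mxlog2 sigma))).

Definition relvar n (rho sigma : 'M[C]_n) : R :=
  complex.Re (\tr (rho *m ((mxlog2 rho - mxlog2 sigma) *m (mxlog2 rho - mxlog2 sigma))))
  - relent rho sigma ^+ 2.

Definition Mx n (x : R) (rho sigma : 'M[C]_n) : R :=
  relvar rho sigma + ((ln 2)^-1 - log2 x - relent rho sigma) ^+ 2.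

Definition ptraceE dS dE (X : 'M[C]_(dS * dE)) : 'M[C]_dS :=
  \matrix_(i, j) \sum_(k < dE) X (mxtens_index (i, k)) (mxtens_index (j, k)).

Definition ptraceS dS dE (X : 'M[C]_(dS * dE)) : 'M[C]_dE :=
  \matrix_(i, j) \sum_(k < dS) X (mxtens_index (k, i)) (mxtens_index (k, j)).

(* ampliation id_k (x) E of a map E on n x n matrices *)
Definition ampl n k (E : 'M[C]_n -> 'M[C]_n) (X : 'M[C]_(k * n)) : 'M[C]_(k * n) :=
  \matrix_(p, q)
     E (\matrix_(i, j) X (mxtens_index ((mxtens_unindex p).1, i))
                         (mxtens_index ((mxtens_unindex q).1, j)))
       (mxtens_unindex p).2 (mxtens_unindex q).2.

Definition channel n (E : 'M[C]_n -> 'M[C]_n) : Prop :=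
  [/\ (forall (a : C) (X Y : 'M[C]_n), E (a *: X + Y) = a *: E X + E Y),
      (forall k (X : 'M[C]_(k * n)), psdmx X -> psdmx (ampl E X)) &
      (forall X, \tr (E X) = \tr X)].

Definition min_eigenvalue n (A : 'M[C]_n) (s : R) : Prop :=
  eigenvalue A s%:C /\ (forall a : C, eigenvalue A a -> s%:C <= a).

End QDefs.

(* Main.v *)
(**
Everything reduces to a classical channel.  Let [V] diagonalise the commuting
pair [rhoS *t rhoE], [sigma], and let [W] be a product basis diagonalising the
output marginals together with [sigS'] and [sigE'].  Preparing in [V], applying
[E] and measuring in [W] is a stochastic matrix taking the spectra [p0], [s0] to
the diagonals [p], [s] of [E (rhoS *t rhoE)] and [sigma'].  Since
[t * (ln t - 1) ^ 2] is concave on [0, 1], [M_x] cannot decrease under this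
matrix when [x <= smin]; with the monotonicity of the relative entropy this gives
[V(p0|s0) - V(p|s) <= 2 (S(p0|s0) - S(p|s)) sqrt M].

The marginals of [p] are the spectra of the output marginals, so it remains to
compare [V(p|s)] with the variance of the product [q] of these marginals.  As
[p <= s / smin], a one-sided estimate of [t ln^2 t - u ln^2 u] bounds the
difference by the Hellinger distance of [p] and [q], hence by the square root of
their relative entropy, which is at most [I] because dephasing in [W] raises the
entropy and leaves [rhoS' *t rhoE'] fixed.
*)

From HB Require Import structures.
From mathcomp Require Import all_boot all_order all_algebra.
From mathcomp Require Import boolp classical_sets reals topology normedtype.
From mathcomp Require Import sequences derive realfun exp.
From mathcomp Require Import complex mxtens.
From mathcomp Require Import ring lra.
Require Import Defs.
Set Implicit Arguments. Unset Strict Implicit. Unset Printing Implicit Defensive.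
Import Order.TTheory GRing.Theory Num.Theory.
Import numFieldNormedType.Exports.
Local Open Scope ring_scope.

(** * Logarithm inequalities *)

Section Scalar.
Variable R : realType.
Implicit Types (t u x y z l : R).

Lemma ln_le_subr1 x : 0 < x -> ln x <= x - 1.
Proof.
move=> x0; have := @le_ln1Dx R (x - 1).
by rewrite [1 + _]addrC subrK ltrBDr addNr; apply.
Qed.

(** The difference of the two sides vanishes at 0 and has derivative [expR y - 1 - y]. *)
Lemma expR_ge_quad y : 0 <= y -> 1 + y + y ^+ 2 / 2 <= expR y.
Proof.
move=> y0.
pose f (x : R) : R := expR x - x - x ^+ 2 / 2.
have df x : is_derive x 1 f (expR x - 1 - x).
  rewrite /f; apply: is_derive_eq.
  by rewrite -![_ *: _]/(_ * _) ?expr1 ?expr0 ?mulr1 ?mulr0 ?add0r; field.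
have cf : {within `[0, y], continuous f}%classic.
  apply: continuous_subspaceT => x.
  apply: differentiable_continuous; apply/derivable1_diffP.
  exact: (@ex_derive _ _ _ _ _ _ _ (df x)).
have := @ger0_derive1_ndecr R f 0 y _ _ cf 0 y (lexx _) y0 (lexx _).
rewrite /f expR0 expr0n /= mul0r !subr0 => H.
have : 1 <= expR y - y - y ^+ 2 / 2.
  apply: H => x.
    by move=> _; exact: (@ex_derive _ _ _ _ _ _ _ (df x)).
  rewrite in_itv/= => /andP[x0 _]; rewrite derive1E (@derive_val _ _ _ _ _ _ _ (df x)).
  by have := expR_ge1Dx x; lra.
lra.
Qed.

(** The right side equals 2 at 0 and has derivative [2 * z * (1 - expR (- z))]. At [z = - y] it says
    [2 * (1 - y) * (expR y - 1 - y) >= y ^+ 2] for [y <= 0]. *)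
Lemma expRN_quad_ge2 z : 0 <= z -> 2 <= 2 * (1 + z) * expR (- z) + z ^+ 2.
Proof.
move=> z0.
pose f (x : R) : R := 2 * (1 + x) * expR (- x) + x ^+ 2.
have df x : is_derive x 1 f (2 * x * (1 - expR (- x))).
  rewrite /f; apply: is_derive_eq.
  by rewrite -![_ *: _]/(_ * _) ?expr1 ?mulr1 ?mulr0 ?addr0 ?add0r; ring.
have cf : {within `[0, z], continuous f}%classic.
  apply: continuous_subspaceT => x.
  apply: differentiable_continuous; apply/derivable1_diffP.
  exact: (@ex_derive _ _ _ _ _ _ _ (df x)).
have := @ger0_derive1_ndecr R f 0 z _ _ cf 0 z (lexx _) z0 (lexx _).
rewrite /f oppr0 expR0 expr0n /= !addr0 !mulr1; apply => x.
  by move=> _; exact: (@ex_derive _ _ _ _ _ _ _ (df x)).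
rewrite in_itv/= => /andP[x0 _]; rewrite derive1E (@derive_val _ _ _ _ _ _ _ (df x)).
rewrite mulr_ge0 ?mulr_ge0 ?(ltW x0) ?subr_ge0 ?expR_le1 ?oppr_le0 ?ltW //.
Qed.

(** Convexity of [t * ln t]: for [t > 0] this is [ln x <= x - 1] at [x = u / t], multiplied by
    [t]. *)
Lemma ln_tangent t u : 0 <= t -> 0 < u -> u * ln u + (1 + ln u) * (t - u) <= t * ln t.
Proof.
move=> t0 u0; move: t0; rewrite le_eqVlt => /predU1P[<-|t0].
  by rewrite mul0r; lra.
have := @ln_le_subr1 (u / t) (divr_gt0 u0 t0).
rewrite ln_div ?posrE // => /(ler_wpM2l (ltW t0)).
by rewrite !mulrBr mulr1 mulrCA mulfV ?gt_eqF// mulr1; lra.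
Qed.

(* The tangent inequality for [t * (ln t - 1) ^+ 2], which is concave on [0, 1]. *)
Lemma lnsq_tangent t u : 0 <= t <= 1 -> 0 < u <= 1 ->
  t * (ln t - 1) ^+ 2 <= u * (ln u - 1) ^+ 2 + (ln u ^+ 2 - 1) * (t - u).
Proof.
move=> /andP[t0 t1] /andP[u0 u1].
have b0 := ln_le0 u1.
move: t0; rewrite le_eqVlt => /predU1P[<-|t0].
  rewrite mul0r sub0r; set b := ln u in b0 *.
  have := mulr_ge0 (ltW u0) (_ : 0 <= 2 - 2 * b); rewrite subr_ge0; nra.
have a0 := ln_le0 t1.
set a := ln t in a0 *; set b := ln u in b0 *.
(* This makes [t] a common factor; what remains involves only [b] and [b - a]. *)
have -> : u = t * expR (b - a) by rewrite expRB /a /b !lnK ?posrE// mulrCA mulfV ?mulr1 ?gt_eqF.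
rewrite -subr_ge0.
suff : 0 <= 2 * (1 - b) * (expR (b - a) - 1 - (b - a)) - (b - a) ^+ 2.
  move=> /(mulr_ge0 (ltW t0)); set e := expR _.
  by congr (0 <= _); ring.
have [y0|y0] := leP 0 (b - a).
  have := expR_ge_quad y0; set y := b - a in y0 *; set e := expR _ => H.
  have := mulr_ge0 (_ : 0 <= 1 - b) (_ : 0 <= e - 1 - y - y ^+ 2 / 2).
  rewrite !subr_ge0 => /(_ ltac:(lra) ltac:(lra)).
  have := mulr_ge0 (_ : 0 <= - b) (sqr_ge0 y); rewrite oppr_ge0 => /(_ b0).
  nra.
have z0 : 0 <= - (b - a) by lra.
have := expRN_quad_ge2 z0; rewrite opprK.
have := expR_ge1Dx (b - a); set y := b - a in y0 z0 *; set e := expR _ => H H2.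
(* [t <= 1] gives [b <= y], so the factor [1 - b] can be lowered to [1 - y], the case covered by
   [expRN_quad_ge2]. *)
have yb : b <= y by rewrite /y; lra.
have := mulr_ge0 (_ : 0 <= y - b) (_ : 0 <= e - 1 - y).
rewrite !subr_ge0 => /(_ ltac:(lra) ltac:(lra)).
nra.
Qed.

(* 2.53 < (9/8)^8 < e *)
Lemma ln_253_le1 : ln (253 / 100 : R) <= 1.
Proof.
rewrite -[leRHS]expRK ler_ln ?posrE ?expR_gt0//; last lra.
have -> : (1 : R) = 8%:R * (1 / 8) by field.
rewrite expRM_natl; have H := @expR_ge1Dx R (1 / 8).
apply: (@le_trans _ _ ((9 / 8) ^+ 8)); first lra.
by apply: lerXn2r; rewrite ?nnegrE ?expR_ge0//; lra.
Qed.

(** The sharp slope is [1 / e]; the rational 253/100 below [e] keeps the constants rational. *)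
Lemma ln_le_mul x : 0 < x -> ln x <= x * (100 / 253).
Proof.
move=> x0; have p0 : 0 < 100 / 253 :> R by lra.
have := ln_le_subr1 (mulr_gt0 x0 p0); rewrite lnM ?posrE//.
rewrite -[100 / 253]invrK lnV ?posrE ?invr_gt0// -[_^-1 in X in _ - X]/(_^-1).
have -> : (100 / 253)^-1 = 253 / 100 :> R by field.
by have := ln_253_le1; lra.
Qed.

(** With [r] the root of [x] the left side is [4 * (r * ln r) ^+ 2], and
    [- (r * ln r) <= 100 / 253]; four times the square of this is just under 5/8. *)
Lemma lnsq_scaled_le x : 0 < x <= 1 -> x * ln x ^+ 2 <= 5 / 8.
Proof.
move=> /andP[x0 x1]; pose r := Num.sqrt x.
have r0 : 0 < r by rewrite sqrtr_gt0.
have rx : r ^+ 2 = x by rewrite sqr_sqrtr ?ltW.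
have := @ln_le_mul r^-1; rewrite invr_gt0 lnV ?posrE// => /(_ r0) H.
have L : ln x = ln r *+ 2 by rewrite -rx lnXn.
have l0 := ln_le0 x1.
have H1 : 0 <= - (r * ln r) <= 100 / 253.
  apply/andP; split; first by rewrite -mulrN mulr_ge0 ?(ltW r0)//; lra.
  by have := ler_wpM2l (ltW r0) H; rewrite mulrN mulrA divff ?gt_eqF// mul1r.
have -> : x * ln x ^+ 2 = 4 * (- (r * ln r)) ^+ 2 by rewrite L -rx; ring.
move: H1; set w := - _ => /andP[w0 w1]; nra.
Qed.

Lemma ln_scaled_le x : 0 < x -> - (x * ln x) <= 1 / 2.
Proof.
move=> x0; have := @ln_le_mul x^-1; rewrite invr_gt0 lnV ?posrE// => /(_ x0) H.
by have := ler_wpM2l (ltW x0) H; rewrite mulrN mulrA divff ?gt_eqF// mul1r; lra.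
Qed.

Lemma lnB_scaled_le x y : 0 < x -> 0 < y -> x * (ln y - ln x) <= y - x.
Proof.
move=> x0 y0; have := @ln_le_subr1 (y / x) (divr_gt0 y0 x0).
rewrite ln_div ?posrE // => /(ler_wpM2l (ltW x0)).
by rewrite !mulrBr mulr1 [x * (y / x)]mulrCA mulfV ?gt_eqF// mulr1; lra.
Qed.

(* Read [t = x ^+ 2], [u = y ^+ 2]: [l] bounds only [ln t], as [t ln^2 t] is increasing
   for [t >= 1]. The last term is the positive part of [t - u]. *)
Lemma sq_lnsq_diff x y l : 0 <= x -> 0 <= y -> ln (x ^+ 2) <= l -> 0 <= l ->
  x ^+ 2 * ln (x ^+ 2) ^+ 2 - y ^+ 2 * ln (y ^+ 2) ^+ 2 <=
  5 * `|x - y| + (l ^+ 2 + 2 * l) * ((`|x ^+ 2 - y ^+ 2| + (x ^+ 2 - y ^+ 2)) / 2).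
Proof.
move=> x0 y0 xl l0.
have pos : 0 <= (`|x ^+ 2 - y ^+ 2| + (x ^+ 2 - y ^+ 2)) / 2.
  by have := ler_norm (- (x ^+ 2 - y ^+ 2)); rewrite normrN; lra.
have L0 : 0 <= l ^+ 2 + 2 * l by have := sqr_ge0 l; lra.
have RHS0 := mulr_ge0 L0 pos.
have n0 := normr_ge0 (x - y).
move: x0; rewrite le_eqVlt => /predU1P[x0|x0].
  have -> : x ^+ 2 = 0 by rewrite -x0 expr0n.
  rewrite mul0r sub0r.
  apply: (@le_trans _ _ 0); first by rewrite oppr_le0 mulr_ge0 ?sqr_ge0.
  by rewrite addr_ge0//; [lra | move: RHS0; rewrite -x0 expr0n].
have lx : ln (x ^+ 2) = 2 * ln x by rewrite lnXn// mulr_natl.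
move: y0; rewrite le_eqVlt => /predU1P[y0|y0].
  move: pos RHS0 n0; rewrite -y0 !expr0n/= mul0r !subr0.
  rewrite !ger0_norm ?(ltW x0) ?sqr_ge0// => pos RHS0 n0.
  have -> : (x ^+ 2 + x ^+ 2) / 2 = x ^+ 2 by field.
  have [x1|x1] := leP x 1.
    have := @lnsq_scaled_le x; rewrite x0 x1 => /(_ isT) H.
    have -> : x ^+ 2 * ln (x ^+ 2) ^+ 2 = 4 * x * (x * ln x ^+ 2) by rewrite lx; ring.
    have := ler_wpM2l (ltW x0) H; lra.
  have a0 := ln_gt0 x1.
  have : ln (x ^+ 2) ^+ 2 <= l ^+ 2 by rewrite lerXn2r ?nnegrE//; lra.
  move=> /(ler_wpM2l (sqr_ge0 x)); have := mulr_ge0 (sqr_ge0 x) l0; lra.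
have ly : ln (y ^+ 2) = 2 * ln y by rewrite lnXn// mulr_natl.
rewrite lx ly in xl *; set a := ln x in xl *; set b := ln y.
have Hxy := lnB_scaled_le x0 y0; have Hyx := lnB_scaled_le y0 x0.
rewrite -/a -/b in Hxy Hyx.
have [xy|yx] := leP x y.
  have ab : a <= b by rewrite ler_ln ?posrE.
  apply: (@le_trans _ _ (5 * `|x - y|)); last by lra.
  have [x1|x1] := leP 1 x.
    have a0 := ln_ge0 x1; apply: (@le_trans _ _ 0); last by rewrite mulr_ge0.
    rewrite subr_le0; apply: ler_pM; rewrite ?sqr_ge0//.
      by rewrite lerXn2r ?nnegrE ?(ltW x0) ?(ltW y0) //.
    by rewrite -/a in a0; rewrite lerXn2r ?nnegrE//; lra.
  rewrite distrC ger0_norm ?subr_ge0//.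
  (* Lowering [y ^+ 2] to [x ^+ 2] in the subtracted term lets the difference factor as
     [4 * (x * (b - a)) * (x * (- a - b))]; the first bracket is at most [y - x], the second at most
     1. *)
  have H : x ^+ 2 * (2 * b) ^+ 2 <= y ^+ 2 * (2 * b) ^+ 2.
    by rewrite ler_wpM2r ?sqr_ge0// lerXn2r ?nnegrE ?(ltW x0) ?(ltW y0) //.
  apply: (@le_trans _ _ (4 * ((x * (b - a)) * (x * (- a - b))))).
    by apply: (le_trans (lerB (lexx _) H)); rewrite le_eqVlt; apply/orP; left; apply/eqP; ring.
  have K := ln_scaled_le x0; rewrite -/a in K.
  have K2 : x * (- a - b) <= 1.
    have := ler_wpM2l (ltW x0) ab; rewrite mulrBr mulrN; lra.
  have K3 : 0 <= x * (b - a) by rewrite mulr_ge0 ?(ltW x0)// subr_ge0.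
  have := ler_wpM2l K3 K2; lra.
have ab : b <= a by rewrite ler_ln ?posrE// ltW.
have sq : 0 <= x ^+ 2 - y ^+ 2 by rewrite subr_ge0 lerXn2r ?nnegrE ?(ltW x0) ?(ltW y0) ?(ltW yx)//.
rewrite (ger0_norm sq) ger0_norm ?subr_ge0 ?(ltW yx)//.
set e := x ^+ 2 - y ^+ 2 in sq *.
have -> : (e + e) / 2 = e by field.
have split : x ^+ 2 * (2 * a) ^+ 2 - y ^+ 2 * (2 * b) ^+ 2 =
   4 * (e * a ^+ 2) + 4 * (y ^+ 2 * (a ^+ 2 - b ^+ 2)) by rewrite /e; ring.
rewrite {}split.
(* For [x <= 1] the second summand is nonpositive and the first is at most
   [4 * 2 * (5 / 8) * (x - y)], the source of the constant 5. *)
have [x1|x1] := leP x 1.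
  have a0 := ln_le0 x1; rewrite -/a in a0.
  have H1 : y ^+ 2 * (a ^+ 2 - b ^+ 2) <= 0.
    rewrite mulr_ge0_le0 ?sqr_ge0// subr_le0 -[a ^+ 2]sqrrN -[b ^+ 2]sqrrN.
    by rewrite lerXn2r ?nnegrE//; lra.
  have := @lnsq_scaled_le x; rewrite x0 x1 => /(_ isT); rewrite -/a => H2.
  have H3 : e * a ^+ 2 <= (x - y) * (2 * (x * a ^+ 2)).
    have -> : e * a ^+ 2 = (x - y) * ((x + y) * a ^+ 2) by rewrite /e; ring.
    rewrite ler_wpM2l ?subr_ge0 ?(ltW yx)// mulrA ler_wpM2r ?sqr_ge0//; lra.
  have H4 : (x - y) * (2 * (x * a ^+ 2)) <= (x - y) * (5 / 4).
    by rewrite ler_wpM2l ?subr_ge0 ?(ltW yx)//; lra.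
  have := mulr_ge0 L0 sq; lra.
have a0 := ln_gt0 x1; rewrite -/a in a0.
have H1 : e * (2 * a) ^+ 2 <= e * l ^+ 2.
  by rewrite ler_wpM2l// lerXn2r ?nnegrE//; lra.
(* When [a + b > 0], [y * (a - b) <= x - y] and [2 * y <= x + y] give the factor [e / 2], and
   [a + b <= 2 * a <= l] gives the other. *)
have H2 : y ^+ 2 * (a ^+ 2 - b ^+ 2) <= e / 2 * l.
  have [s0|s0] := leP (a + b) 0.
    apply: (@le_trans _ _ 0); last by rewrite mulr_ge0//; lra.
    rewrite mulr_ge0_le0 ?sqr_ge0//.
    have -> : a ^+ 2 - b ^+ 2 = (a - b) * (a + b) by ring.
    by rewrite mulr_ge0_le0// subr_ge0.
  have -> : y ^+ 2 * (a ^+ 2 - b ^+ 2) = (y * (y * (a - b))) * (a + b) by ring.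
  apply: ler_pM; [|by lra| |by lra].
    by rewrite !mulr_ge0 ?(ltW y0)// subr_ge0.
  apply: (le_trans (ler_wpM2l (ltW y0) Hyx)); rewrite /e; nra.
have H3 : 0 <= x - y by rewrite subr_ge0 ltW.
by nra.
Qed.

End Scalar.

(** * Relative entropy and variance of finite distributions *)

Section Classical.
Variable R : realType.

(* Since [ln 0 = 0], indices with [p i = 0] contribute nothing, as in the convention
   [0 ln 0 = 0]; but a zero of [s] where [p] is positive does not give infinity. *)
Definition kl (I : finType) (p s : I -> R) : R := \sum_i p i * (ln (p i) - ln (s i)).

(* For [c = 1 - ln x] this is [(ln 2)^2 M_x]. *)
Definition lrsq (c : R) (I : finType) (p s : I -> R) : R :=
  \sum_i p i * (ln (p i) - ln (s i) - c) ^+ 2.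

(** * Monotonicity under stochastic matrices *)

Lemma jensen_stoch (I J : finType) (phi : R -> R) (T : J -> I -> R)
    (p0 s0 : I -> R) (p s : J -> R) :
  (forall i, 0 < s0 i) -> (forall j, 0 < s j) ->
  (forall j i, 0 <= T j i) -> (forall i, \sum_j T j i = 1) ->
  (forall j, s j = \sum_i T j i * s0 i) -> (forall j, p j = \sum_i T j i * p0 i) ->
  (forall j, exists c, forall i, T j i != 0 ->
     phi (p j / s j) + c * (p0 i / s0 i - p j / s j) <= phi (p0 i / s0 i)) ->
  \sum_j s j * phi (p j / s j) <= \sum_i s0 i * phi (p0 i / s0 i).
Proof.
move=> s00 s_gt0 T0 T1 sE pE tangent.
have -> : \sum_i s0 i * phi (p0 i / s0 i) =
          \sum_j \sum_i T j i * (s0 i * phi (p0 i / s0 i)).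
  by rewrite exchange_big /=; apply: eq_bigr => i _; rewrite -mulr_suml T1 mul1r.
apply: ler_sum => j _; have [c Hc] := tangent j.
set u := p j / s j in Hc *.
(* Jensen: [u] is the mean of the ratios [p0 i / s0 i] with weights [T j i * s0 i / s j], so the
   slope term sums to [c * (p j - s j * u) = 0]. *)
have -> : s j * phi u = \sum_i T j i * (s0 i * (phi u + c * (p0 i / s0 i - u))).
  transitivity (s j * phi u + c * (p j - s j * u)).
    by rewrite /u mulrCA divff ?gt_eqF// mulr1 subrr mulr0 addr0.
  rewrite mulrBr {1 2}sE pE mulr_sumr !mulr_suml mulr_sumr -sumrB -big_split /=.
  apply: eq_bigr => i _; have := s00 i => si; field.
  by rewrite gt_eqF.
apply: ler_sum => i _; have [->|Tn0] := eqVneq (T j i) 0; first by rewrite !mul0r.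
by rewrite ler_wpM2l// ler_wpM2l ?(ltW (s00 i))// Hc.
Qed.

Lemma kl_perspective (I : finType) (p s : I -> R) :
  (forall i, 0 <= p i) -> (forall i, 0 < s i) ->
  kl p s = \sum_i s i * (p i / s i * ln (p i / s i)).
Proof.
move=> p0 s0; apply: eq_bigr => i _; rewrite mulrA [s i * _]mulrCA divff ?gt_eqF// mulr1.
have := p0 i; rewrite le_eqVlt => /predU1P[<-|pi]; first by rewrite !mul0r.
by rewrite ln_div ?posrE.
Qed.

(** Scaling the ratio by [x] turns the shift [1 - ln x] into 1, giving the function of
    [lnsq_tangent] at [x * (p i / s i)], up to a factor [1 / x]. *)
Lemma lrsq_perspective (x : R) (I : finType) (p s : I -> R) :
  0 < x -> (forall i, 0 <= p i) -> (forall i, 0 < s i) ->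
  lrsq (1 - ln x) p s = \sum_i s i * (p i / s i * (ln (x * (p i / s i)) - 1) ^+ 2).
Proof.
move=> x0 p0 s0; apply: eq_bigr => i _; rewrite mulrA [s i * _]mulrCA divff ?gt_eqF// mulr1.
have := p0 i; rewrite le_eqVlt => /predU1P[<-|pi]; first by rewrite !mul0r.
rewrite lnM ?posrE ?divr_gt0// ln_div ?posrE//; congr (_ * _ ^+ 2); ring.
Qed.

Section Stochastic.
Variables (I J : finType) (T : J -> I -> R) (p0 s0 : I -> R) (p s : J -> R).
Hypothesis p00 : forall i, 0 <= p0 i.
Hypothesis s00 : forall i, 0 < s0 i.
Hypothesis s_gt0 : forall j, 0 < s j.
Hypothesis T0 : forall j i, 0 <= T j i.
Hypothesis T1 : forall i, \sum_j T j i = 1.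
Hypothesis sE : forall j, s j = \sum_i T j i * s0 i.
Hypothesis pE : forall j, p j = \sum_i T j i * p0 i.

Lemma stoch_ge0 j : 0 <= p j.
Proof. by rewrite pE sumr_ge0// => i _; rewrite mulr_ge0. Qed.

Lemma stoch_ratio_eq0 j : p j = 0 -> forall i, T j i != 0 -> p0 i = 0.
Proof.
move=> pj0 i Tn0; have : \sum_i T j i * p0 i == 0 by rewrite -pE pj0.
rewrite psumr_eq0 => [|k _]; last by rewrite mulr_ge0.
by move=> /allP/(_ i); rewrite mem_index_enum mulf_eq0 (negPf Tn0) => /(_ isT)/eqP.
Qed.

(** Data processing, by Jensen for [t * ln t]. *)
Lemma kl_stoch : kl p s <= kl p0 s0.
Proof.
rewrite (kl_perspective p00 s00) (kl_perspective stoch_ge0 s_gt0).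
apply: (jensen_stoch (phi := fun t => t * ln t) s00 s_gt0 T0 T1 sE pE) => j.
have := stoch_ge0 j; rewrite le_eqVlt => /predU1P[/esym pj0|pj].
  (* [t * ln t] has no tangent at 0, but all ratios of nonzero weight are 0 here, so any slope
     serves. *)
  exists 0 => i /(stoch_ratio_eq0 pj0) ->.
  by rewrite pj0 !mul0r addr0.
exists (1 + ln (p j / s j)) => i _.
by rewrite ln_tangent ?divr_gt0 ?divr_ge0// ltW.
Qed.

Lemma stoch_ratio_le (l : R) : (forall i, p0 i <= l * s0 i) -> forall j, p j <= l * s j.
Proof.
move=> H j; rewrite pE sE mulr_sumr; apply: ler_sum => i _.
by rewrite mulrCA ler_wpM2l.
Qed.

(** The direction is opposite to [kl_stoch] because the function is concave on [0, 1]. The bound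
    [x * p0 i <= s0 i] confines the scaled ratios to that interval, and averaging keeps them
    there. *)
Lemma lrsq_stoch (x : R) : 0 < x -> (forall i, x * p0 i <= s0 i) ->
  lrsq (1 - ln x) p0 s0 <= lrsq (1 - ln x) p s.
Proof.
move=> x0 xp0; have xp j : x * p j <= s j.
  rewrite -ler_pdivlMl//; apply: stoch_ratio_le => i.
  by rewrite ler_pdivlMl.
rewrite (lrsq_perspective x0 p00 s00) (lrsq_perspective x0 stoch_ge0 s_gt0).
rewrite -lerN2 -!sumrN; under eq_bigr do rewrite -mulrN.
under [leRHS]eq_bigr do rewrite -mulrN.
apply: (jensen_stoch (phi := fun t => - (t * (ln (x * t) - 1) ^+ 2)) s00 s_gt0 T0 T1 sE pE) => j.
have := stoch_ge0 j; rewrite le_eqVlt => /predU1P[/esym pj0|pj].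
  exists 0 => i /(stoch_ratio_eq0 pj0) ->.
  by rewrite pj0 !mul0r addr0.
set u := p j / s j; have u0 : 0 < u by rewrite divr_gt0.
exists (1 - ln (x * u) ^+ 2) => i _; set t := p0 i / s0 i.
have t0 : 0 <= t by rewrite divr_ge0// ltW.
have H := @lnsq_tangent R (x * t) (x * u).
have Ht : 0 <= x * t <= 1.
  by rewrite mulr_ge0 ?(ltW x0)//= /t mulrA ler_pdivrMr// mul1r.
have Hu : 0 < x * u <= 1.
  by rewrite mulr_gt0//= /u mulrA ler_pdivrMr// mul1r.
have {}H := H Ht Hu.
rewrite -(ler_pM2l x0) -subr_ge0; move: H; rewrite -subr_ge0.
by congr (0 <= _); ring.
Qed.

End Stochastic.

(** Lagrange's identity: the gap is half the double sum of [(a i * b j - a j * b i) ^+ 2]. *)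
Lemma cauchy_schwarz_sum (I : finType) (a b : I -> R) :
  (\sum_i a i * b i) ^+ 2 <= (\sum_i a i ^+ 2) * (\sum_i b i ^+ 2).
Proof.
have H : 0 <= \sum_i \sum_j (a i * b j - a j * b i) ^+ 2.
  by apply: sumr_ge0 => i _; apply: sumr_ge0 => j _; rewrite sqr_ge0.
have E : \sum_i \sum_j (a i * b j - a j * b i) ^+ 2 =
  2 * ((\sum_i a i ^+ 2) * (\sum_i b i ^+ 2) - (\sum_i a i * b i) ^+ 2).
  transitivity (\sum_i \sum_j (a i ^+ 2 * b j ^+ 2 + b i ^+ 2 * a j ^+ 2
      + - 2 * (a i * b i) * (a j * b j))).
    by apply: eq_bigr => i _; apply: eq_bigr => j _; ring.
  under eq_bigr do rewrite !big_split /= -!mulr_sumr.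
  rewrite !big_split /= -!mulr_suml -mulr_sumr; ring.
by move: H; rewrite E pmulr_rge0// subr_ge0.
Qed.

(** * Hellinger distance, total variation and second moments *)

Section Distributions.
Variables (I : finType) (p q : I -> R).
Hypothesis p0 : forall i, 0 <= p i.
Hypothesis p1 : \sum_i p i = 1.
Hypothesis q0 : forall i, 0 <= q i.
Hypothesis q1 : \sum_i q i = 1.
Hypothesis pq : forall i, q i = 0 -> p i = 0.

(** The squared Hellinger distance without the customary factor 1/2. *)
Definition hellinger : R := \sum_i (Num.sqrt (p i) - Num.sqrt (q i)) ^+ 2.

(** As both masses are 1, the distance is the sum of [2 * (p i - sqrt (p i) * sqrt (q i))]; each
    term is bounded through [ln z <= z - 1] at the root [z] of [q i / p i]. *)
Lemma hellinger_le_kl : hellinger <= kl p q.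
Proof.
have -> : hellinger = \sum_i (q i - p i + 2 * (p i - Num.sqrt (p i) * Num.sqrt (q i))).
  apply: eq_bigr => i _; rewrite sqrrB !sqr_sqrtr//; ring.
rewrite big_split /= sumrB p1 q1 subrr add0r; apply: ler_sum => i _.
have := p0 i; rewrite le_eqVlt => /predU1P[<-|pi]; first by rewrite sqrtr0 !mul0r subrr mulr0.
have qi : 0 < q i.
  by rewrite lt_def q0 andbT; apply: contraL pi => /eqP/pq ->; rewrite ltxx.
have L (y : R) : 0 < y -> ln y = 2 * ln (Num.sqrt y).
  by move=> y0; rewrite mulr_natl -lnXn ?sqrtr_gt0// sqr_sqrtr// ltW.
have := @lnB_scaled_le R (Num.sqrt (p i)) (Num.sqrt (q i)).
rewrite !sqrtr_gt0 => /(_ pi qi) /(ler_wpM2l (sqrtr_ge0 (p i))).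
have := sqr_sqrtr (ltW pi); rewrite (L _ pi) (L _ qi).
move: (Num.sqrt (p i)) (Num.sqrt (q i)) (ln _) (ln _) => a b la lb <-.
rewrite -subr_ge0 => H; rewrite -subr_ge0.
have -> : a ^+ 2 * (2 * la - 2 * lb) - 2 * (a ^+ 2 - a * b) =
  2 * (a * (b - a) - a * (a * (lb - la))) by ring.
by rewrite mulr_ge0.
Qed.

Lemma kl_ge0 : 0 <= kl p q.
Proof. by apply: le_trans hellinger_le_kl; apply: sumr_ge0 => i _; rewrite sqr_ge0. Qed.

(** Factor [p i - q i] through the square roots and apply Cauchy-Schwarz; the sum of
    [(sqrt (p i) + sqrt (q i)) ^+ 2] is at most 4. *)
Lemma tv_le_kl : (\sum_i `|p i - q i|) / 2 <= Num.sqrt (kl p q).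
Proof.
apply: le_trans (ler_wsqrtr hellinger_le_kl).
have -> : \sum_i `|p i - q i| =
    \sum_i `|Num.sqrt (p i) - Num.sqrt (q i)| * (Num.sqrt (p i) + Num.sqrt (q i)).
  apply: eq_bigr => i _; rewrite -{1}(sqr_sqrtr (p0 i)) -{1}(sqr_sqrtr (q0 i)).
  by rewrite subr_sqr normrM [X in _ * X]ger0_norm ?addr_ge0 ?sqrtr_ge0.
set S := \sum_i _.
have S0 : 0 <= S.
  by apply: sumr_ge0 => i _; rewrite mulr_ge0 ?addr_ge0 ?sqrtr_ge0.
rewrite -[leLHS]ger0_norm ?divr_ge0// -sqrtr_sqr ler_wsqrtr//.
rewrite exprMn -ler_pdivlMr ?exprVn ?invr_gt0 ?exprn_gt0// invrK.
apply: (le_trans (cauchy_schwarz_sum _ _)); rewrite /hellinger.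
under eq_bigr do rewrite real_normK ?num_real//.
apply: ler_wpM2l; first by apply: sumr_ge0 => i _; rewrite sqr_ge0.
apply: (@le_trans _ _ (\sum_i (2 * p i + 2 * q i))).
  apply: ler_sum => i _; rewrite -{2}(sqr_sqrtr (p0 i)) -{2}(sqr_sqrtr (q0 i)).
  by have := sqr_ge0 (Num.sqrt (p i) - Num.sqrt (q i)); lra.
by rewrite big_split /= -!mulr_sumr p1 q1; lra.
Qed.

(** Apply [sq_lnsq_diff] to the roots of [p i / s i] and [q i / s i], weighted by [s i]. The root
    difference becomes a Hellinger term by Cauchy-Schwarz, the positive part becomes total
    variation. *)
Lemma lrsq_diff (s : I -> R) (l : R) : (forall i, 0 < s i) -> \sum_i s i = 1 ->
  0 <= l -> (forall i, p i <= expR l * s i) ->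
  lrsq 0 p s - lrsq 0 q s <= (5 + (l ^+ 2 + 2 * l)) * Num.sqrt (kl p q).
Proof.
move=> s0 s1 l0 ps.
have E (r : I -> R) i : 0 <= r i -> r i * (ln (r i) - ln (s i) - 0) ^+ 2 =
    s i * (Num.sqrt (r i / s i) ^+ 2 * ln (Num.sqrt (r i / s i) ^+ 2) ^+ 2).
  move=> ri; rewrite sqr_sqrtr ?divr_ge0 ?(ltW (s0 i))//.
  rewrite [RHS]mulrA [s i * (_ / _)]mulrCA divff ?gt_eqF// mulr1 subr0.
  move: ri; rewrite le_eqVlt => /predU1P[<-|ri]; first by rewrite !mul0r.
  by rewrite ln_div ?posrE.
rewrite -sumrB.
apply: (@le_trans _ _ (\sum_i (5 * (Num.sqrt (s i) * `|Num.sqrt (p i) - Num.sqrt (q i)|)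
    + (l ^+ 2 + 2 * l) * ((`|p i - q i| + (p i - q i)) / 2)))).
  apply: ler_sum => i _; rewrite !E// -mulrBr.
  set x := Num.sqrt (p i / s i); set y := Num.sqrt (q i / s i).
  have xl : ln (x ^+ 2) <= l.
    rewrite /x sqr_sqrtr ?divr_ge0 ?(ltW (s0 i))//.
    have := p0 i; rewrite le_eqVlt => /predU1P[<-|pi]; first by rewrite mul0r ln0.
    by rewrite -[leRHS]expRK ler_ln ?posrE ?divr_gt0 ?expR_gt0// ler_pdivrMr.
  have := @sq_lnsq_diff R x y l (sqrtr_ge0 _) (sqrtr_ge0 _) xl l0.
  move=> /(ler_wpM2l (ltW (s0 i))); move/le_trans; apply.
  have ss : s i = Num.sqrt (s i) * Num.sqrt (s i) by rewrite -expr2 sqr_sqrtr// ltW.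
  have sx (r : R) : 0 <= r -> Num.sqrt (s i) * Num.sqrt (r / s i) = Num.sqrt r.
    move=> r0; rewrite -sqrtrM ?(ltW (s0 i))// mulrCA divff ?gt_eqF// mulr1 //.
  have e1 : s i * `|x - y| = Num.sqrt (s i) * `|Num.sqrt (p i) - Num.sqrt (q i)|.
    rewrite {1}ss -mulrA -{2}[Num.sqrt (s i)]ger0_norm ?sqrtr_ge0// -normrM mulrBr.
    by rewrite /x /y !sx.
  have e2 : s i * (x ^+ 2 - y ^+ 2) = p i - q i.
    rewrite /x /y !sqr_sqrtr ?divr_ge0 ?(ltW (s0 i))// mulrBr.
    by rewrite ![s i * (_ / _)]mulrCA divff ?gt_eqF// !mulr1.
  have e3 : s i * `|x ^+ 2 - y ^+ 2| = `|p i - q i|.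
    by rewrite -{1}[s i]ger0_norm ?(ltW (s0 i))// -normrM e2.
  by rewrite -e1 -e3 -e2 le_eqVlt; apply/orP; left; apply/eqP; field.
rewrite big_split /= -!mulr_sumr [leRHS]mulrDl; apply: lerD.
  rewrite ler_wpM2l//; apply: le_trans (ler_wsqrtr hellinger_le_kl).
  set S := \sum_i _.
  have S0 : 0 <= S.
    by apply: sumr_ge0 => i _; rewrite mulr_ge0 ?sqrtr_ge0.
  rewrite -[leLHS]ger0_norm// -sqrtr_sqr ler_wsqrtr//.
  apply: (le_trans (cauchy_schwarz_sum _ _)).
  under eq_bigr do rewrite sqr_sqrtr ?(ltW (s0 _))//.
  by rewrite s1 mul1r; under eq_bigr do rewrite real_normK ?num_real//.
rewrite ler_wpM2l//; first by have := sqr_ge0 l; lra.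
(* The signed differences sum to 0, leaving half the [l1] distance. *)
by rewrite -mulr_suml big_split /= sumrB p1 q1 subrr addr0 tv_le_kl.
Qed.

End Distributions.

(** Variance of the log ratio in nats: [ln 2 ^+ 2] times the relative entropy variance. *)
Definition lrvar (I : finType) (p s : I -> R) : R := lrsq 0 p s - kl p s ^+ 2.

(** Bias-variance identity; it gives the second moment the shape of [M_x]. *)
Lemma lrsqE (c : R) (I : finType) (p s : I -> R) : \sum_i p i = 1 ->
  lrsq c p s = lrvar p s + (c - kl p s) ^+ 2.
Proof.
move=> p1; have -> : lrsq c p s = lrsq 0 p s - 2 * c * kl p s + c ^+ 2 * \sum_i p i.
  rewrite /lrsq /kl !mulr_sumr -sumrB -big_split /=.
  by apply: eq_bigr => i _; ring.
by rewrite p1 /lrvar; ring.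
Qed.

Lemma lrvar_ge0 (I : finType) (p s : I -> R) :
  (forall i, 0 <= p i) -> \sum_i p i = 1 -> 0 <= lrvar p s.
Proof.
move=> p0 p1; have := @lrsqE (kl p s) I p s p1; rewrite subrr expr0n addr0 => <-.
by apply: sumr_ge0 => i _; rewrite mulr_ge0 ?sqr_ge0.
Qed.

(** With [r] the root, the last hypothesis bounds [W0 - W1] by [D * (2 * a + D)], enough when
    [a + D <= r]. Otherwise [r - a < D], and already [W0 = (r - a) * (r + a)] is at most
    [2 * D * r]. *)
Lemma var_drop_le (W0 W1 a D : R) : 0 <= a -> 0 <= W0 -> 0 <= W1 -> 0 <= D ->
  W0 + a ^+ 2 <= W1 + (a + D) ^+ 2 -> W0 - W1 <= 2 * D * Num.sqrt (W0 + a ^+ 2).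
Proof.
move=> a0 W00 W10 D0 H; have M0 : 0 <= W0 + a ^+ 2 by rewrite addr_ge0 ?sqr_ge0.
set r := Num.sqrt _; have r0 : 0 <= r := sqrtr_ge0 _.
have r2 : r ^+ 2 = W0 + a ^+ 2 by rewrite sqr_sqrtr.
have ar : a <= r by rewrite -(ler_sqr (x := a)) ?nnegrE// r2; lra.
have [h|h] := leP (a + D) r; first by nra.
have : (r - a) * r <= D * r by rewrite ler_wpM2r//; lra.
have : (r - a) * (r + a) <= (r - a) * (2 * r) by rewrite ler_wpM2l//; lra.
have : (r - a) * (r + a) = W0 by rewrite -subr_sqr r2; ring.
lra.
Qed.

Lemma sum_pair (X Y : finType) (F : X * Y -> R) :
  \sum_i F i = \sum_x \sum_y F (x, y).
Proof. by rewrite (pair_bigA _ (fun x y => F (x, y))); apply: eq_bigr => -[]. Qed.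

(** * Product distributions *)

Section Tensor.
Variables (X Y : finType) (a al : X -> R) (b be : Y -> R).
Hypothesis a0 : forall x, 0 <= a x.
Hypothesis a1 : \sum_x a x = 1.
Hypothesis b0 : forall y, 0 <= b y.
Hypothesis b1 : \sum_y b y = 1.
Hypothesis al0 : forall x, 0 < al x.
Hypothesis be0 : forall y, 0 < be y.
Let ab (i : X * Y) := a i.1 * b i.2.
Let albe (i : X * Y) := al i.1 * be i.2.

Lemma prod_sum1 : \sum_i ab i = 1.
Proof.
by rewrite sum_pair /ab /=; under eq_bigr do rewrite -mulr_sumr b1 mulr1.
Qed.

(** The weight stays in front because [ln] of a product splits only for positive factors; the other
    indices have weight 0. A general [F] serves both moments. *)
Lemma prod_log_ratio (F : R -> R) x y : ab (x, y) * F (ln (ab (x, y)) - ln (albe (x, y))) =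
  ab (x, y) * F ((ln (a x) - ln (al x)) + (ln (b y) - ln (be y))).
Proof.
rewrite /ab /albe /=; have := a0 x; rewrite le_eqVlt => /predU1P[<-|ax]; first by rewrite !mul0r.
have := b0 y; rewrite le_eqVlt => /predU1P[<-|bx]; first by rewrite mulr0 !mul0r.
by rewrite !lnM ?posrE//; congr (_ * F _); ring.
Qed.

Lemma kl_prod : kl ab albe = kl a al + kl b be.
Proof.
rewrite /kl sum_pair; under eq_bigr do under eq_bigr do rewrite (prod_log_ratio id).
transitivity (\sum_x (a x * (ln (a x) - ln (al x)) * \sum_y b y +
   a x * \sum_y b y * (ln (b y) - ln (be y)))).
  apply: eq_bigr => x _; rewrite !mulr_sumr -big_split /=.
  by apply: eq_bigr => y _; rewrite /ab /=; ring.
by rewrite b1 big_split /= -!mulr_suml a1 mulr1 mul1r.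
Qed.

(** The two log ratios are independent: the cross term [2 * kl a al * kl b be] cancels against the
    square of the mean. *)
Lemma lrvar_prod : lrvar ab albe = lrvar a al + lrvar b be.
Proof.
rewrite /lrvar kl_prod.
have -> : lrsq 0 ab albe = lrsq 0 a al + 2 * kl a al * kl b be + lrsq 0 b be.
  rewrite /lrsq sum_pair.
  under eq_bigr do under eq_bigr do rewrite (prod_log_ratio (fun t => (t - 0) ^+ 2)).
  transitivity (\sum_x (a x * (ln (a x) - ln (al x) - 0) ^+ 2 * \sum_y b y +
     2 * (a x * (ln (a x) - ln (al x))) * kl b be +
     a x * \sum_y b y * (ln (b y) - ln (be y) - 0) ^+ 2)).
    apply: eq_bigr => x _; rewrite !mulr_sumr -!big_split /=.
    by apply: eq_bigr => y _; rewrite /ab /=; ring.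
  by rewrite b1 !big_split /= -!mulr_suml -mulr_sumr a1 mulr1 mul1r.
ring.
Qed.

End Tensor.

(** * Joint distributions against the product of their marginals *)

Definition marg1 (X Y : finType) (p : X * Y -> R) x := \sum_y p (x, y).
Definition marg2 (X Y : finType) (p : X * Y -> R) y := \sum_x p (x, y).

Section Joint.
Variables (X Y : finType) (p : X * Y -> R) (al : X -> R) (be : Y -> R).
Hypothesis p0 : forall i, 0 <= p i.
Hypothesis p1 : \sum_i p i = 1.
Hypothesis al0 : forall x, 0 < al x.
Hypothesis be0 : forall y, 0 < be y.
Let s (i : X * Y) := al i.1 * be i.2.
Let q (i : X * Y) := marg1 p i.1 * marg2 p i.2.

Lemma marg1_ge0 x : 0 <= marg1 p x. Proof. exact: sumr_ge0. Qed.
Lemma marg2_ge0 x : 0 <= marg2 p x. Proof. exact: sumr_ge0. Qed.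
Lemma marg1_sum1 : \sum_x marg1 p x = 1. Proof. by rewrite -p1 sum_pair. Qed.
Lemma marg2_sum1 : \sum_x marg2 p x = 1.
Proof. by rewrite -p1 sum_pair exchange_big. Qed.

Lemma marg1_eq0 x y : marg1 p x = 0 -> p (x, y) = 0.
Proof.
by move=> /eqP; rewrite psumr_eq0// => /allP/(_ y); rewrite mem_index_enum => /(_ isT)/eqP.
Qed.

Lemma marg2_eq0 x y : marg2 p y = 0 -> p (x, y) = 0.
Proof.
by move=> /eqP; rewrite psumr_eq0// => /allP/(_ x); rewrite mem_index_enum => /(_ isT)/eqP.
Qed.

Lemma prod_marg_dom i : q i = 0 -> p i = 0.
Proof.
case: i => x y; rewrite /q /= => /eqP; rewrite mulf_eq0 => /orP[]/eqP.
  exact: marg1_eq0.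
exact: marg2_eq0.
Qed.

(** The log ratio passes through the product [q] of the marginals; the rest is a sum of functions of
    one coordinate, which see only the marginals. *)
Lemma kl_chain : kl p s = kl p q + (kl (marg1 p) al + kl (marg2 p) be).
Proof.
have -> : kl (marg1 p) al = \sum_i p i * (ln (marg1 p i.1) - ln (al i.1)).
  by rewrite sum_pair /=; apply: eq_bigr => x _; rewrite -mulr_suml.
have -> : kl (marg2 p) be = \sum_i p i * (ln (marg2 p i.2) - ln (be i.2)).
  by rewrite sum_pair exchange_big /=; apply: eq_bigr => x _; rewrite -mulr_suml.
rewrite -!big_split /=; apply: eq_bigr => -[x y] _.
have := p0 (x, y); rewrite le_eqVlt => /predU1P[<-|pxy]; first by rewrite !mul0r !addr0.
have m1 : 0 < marg1 p x.
  by rewrite lt_def marg1_ge0 andbT; apply: contraL pxy => /eqP/(marg1_eq0 y)->; rewrite ltxx.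
have m2 : 0 < marg2 p y.
  by rewrite lt_def marg2_ge0 andbT; apply: contraL pxy => /eqP/(marg2_eq0 x)->; rewrite ltxx.
by rewrite /q /s /= !lnM ?posrE//; ring.
Qed.

(** [lrsq_diff] compares the second moments of [p] and [q]. The subtracted squared means go the
    right way, since [0 <= kl q s <= kl p s] by the chain rule. *)
Lemma lrvar_subadd (l : R) :
  \sum_x al x = 1 -> \sum_y be y = 1 -> 0 <= l -> (forall i, p i <= expR l * s i) ->
  lrvar p s <= lrvar (marg1 p) al + lrvar (marg2 p) be +
    (5 + (l ^+ 2 + 2 * l)) * Num.sqrt (kl p q).
Proof.
move=> al1 be1 l0 ps; have s0 i : 0 < s i by rewrite mulr_gt0.
have s1 : \sum_i s i = 1 := prod_sum1 al1 be1.
have q0 i : 0 <= q i by rewrite mulr_ge0 ?marg1_ge0 ?marg2_ge0.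
have q1 : \sum_i q i = 1 := prod_sum1 marg1_sum1 marg2_sum1.
have := lrsq_diff p0 p1 q0 q1 prod_marg_dom s0 s1 l0 ps.
rewrite -(lrvar_prod marg1_ge0 marg1_sum1 marg2_ge0 marg2_sum1 al0 be0) -/q -/s.
have klq : kl q s = kl (marg1 p) al + kl (marg2 p) be.
  exact: kl_prod marg1_ge0 marg1_sum1 marg2_ge0 marg2_sum1 al0 be0.
have kq0 : 0 <= kl q s.
  apply: (kl_ge0 q0 q1 _ s1) => i; first exact: ltW.
  by move=> si; have := s0 i; rewrite si ltxx.
have kp0 := kl_ge0 p0 p1 q0 q1 prod_marg_dom.
have : kl q s ^+ 2 <= kl p s ^+ 2.
  by rewrite lerXn2r ?nnegrE// kl_chain -?klq; lra.
rewrite /lrvar; lra.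
Qed.

End Joint.

(** The log ratios are at most [- ln m], so the shift [1 - ln m] exceeds [kl p0 s0] by at least 1
    and the second moment is at least 1. Then [var_drop_le] applies with [a = 1 - ln m - kl p0 s0]
    and [D] the drop of [kl]. *)
Lemma lrvar_stoch_drop (I J : finType) (T : J -> I -> R) (p0 s0 : I -> R) (p s : J -> R) (m : R) :
  (forall i, 0 <= p0 i) -> \sum_i p0 i = 1 -> (forall i, 0 < s0 i) ->
  (forall j, 0 < s j) -> (forall j i, 0 <= T j i) -> (forall i, \sum_j T j i = 1) ->
  (forall j, s j = \sum_i T j i * s0 i) -> (forall j, p j = \sum_i T j i * p0 i) ->
  0 < m -> (forall i, m <= s0 i) ->
  [/\ 1 <= lrsq (1 - ln m) p0 s0,
      forall j, p j <= expR (- ln m) * s j &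
      lrvar p0 s0 - lrvar p s <= 2 * (kl p0 s0 - kl p s) * Num.sqrt (lrsq (1 - ln m) p0 s0)].
Proof.
move=> p00 p01 s00 sj0 T0 T1 sE pE m0 ms.
have p0le i : p0 i <= 1 by rewrite -p01 (bigD1 i)//= lerDl sumr_ge0.
have mp i : m * p0 i <= s0 i.
  by apply: le_trans (ms i); rewrite ler_piMr// ltW.
have pj0 := stoch_ge0 p00 T0 pE.
have pj1 : \sum_j p j = 1.
  under eq_bigr do rewrite pE.
  by rewrite exchange_big /=; under eq_bigr do rewrite -mulr_suml T1 mul1r.
have klm : kl p0 s0 <= - ln m.
  rewrite -[leRHS]mul1r -p01 mulr_suml; apply: ler_sum => i _; rewrite ler_wpM2l//.
  have := ln_le0 (p0le i); have : ln m <= ln (s0 i) by rewrite ler_ln ?posrE.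
  lra.
have D0 := kl_stoch p00 s00 sj0 T0 T1 sE pE.
have M := lrsq_stoch p00 s00 sj0 T0 T1 sE pE m0 mp.
have V0 := lrvar_ge0 s0 p00 p01.
have V1 := lrvar_ge0 s pj0 pj1.
rewrite !lrsqE// in M *; split.
- by rewrite -[leLHS]add0r lerD// -[leLHS](expr1n _ 2) lerXn2r ?nnegrE//; lra.
- apply: (stoch_ratio_le T0 sE pE) => i.
  by rewrite expRN lnK ?posrE// ler_pdivlMl.
apply: var_drop_le => //; [lra|lra|].
by apply: le_trans M _; rewrite le_eqVlt; apply/orP; left; apply/eqP; ring.
Qed.

(** * Numerical constants *)

Lemma ln2_ge67 : 67 / 100 <= ln (2 : R).
Proof.
(* 1.044^16 < 2 *)
pose x : R := 1044 / 1000.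
have x0 : 0 < x by rewrite /x; lra.
have H : ln (x ^+ 16) <= ln 2.
  by rewrite ler_ln ?posrE ?exprn_gt0// /x; lra.
have := @ln_le_subr1 R x^-1; rewrite invr_gt0 lnV ?posrE// => /(_ x0) H2.
have E : x^-1 = 1000 / 1044 by rewrite /x; field.
by rewrite E in H2; rewrite lnXn// in H; lra.
Qed.

(** The fourth root exceeds the square root for [x <= 1], the square does for [x > 1]. *)
Lemma sqrt_le_max (x : R) : 0 <= x -> Num.sqrt x <= Num.max (x `^ (4%:R)^-1) (x ^+ 2).
Proof.
rewrite le_eqVlt => /predU1P[<-|x0]; first by rewrite sqrtr0 le_max powR_ge0.
have [x1|x1] := leP x 1; rewrite le_max.
  have x01 : 0 < x <= 1 by rewrite x0.
  by apply/orP; left; rewrite -powR12_sqrt ?(ltW x0)//; apply: (ger_powR x01); lra.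
apply/orP; right; have r0 := sqrtr_ge0 x; have r2 := sqr_sqrtr (ltW x0).
have r1 : 1 <= Num.sqrt x by rewrite -sqrtr1 ler_wsqrtr// ltW.
rewrite -[in leRHS]r2; move: (Num.sqrt x) r0 r1 => r r0 r1.
have := exprn_ege1 3 r1; rewrite -exprM => /(ler_wpM2l r0).
by rewrite mulr1 -exprS.
Qed.

(** Converts units: [l] is in nats, [I], [Ic] and [d] in bits; [- l / ln 2] will be [log2 smin] and
    [d] the [log2] of the dimension. *)
Lemma coef_bound (l I Ic d : R) : 0 <= l -> 0 <= Ic -> Ic <= I ->
  (5 + (l ^+ 2 + 2 * l)) * Num.sqrt (ln 2 * Ic) / ln 2 ^+ 2 <=
  Num.sqrt (2 * ln 2) * (12 + (- l / ln 2) ^+ 2 + 8 * d ^+ 2) *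
  Num.max (I `^ (4%:R)^-1) (I ^+ 2).
Proof.
move=> l0 Ic0 IcI; have L := ln2_ge67; set L2 := ln 2 in L *.
have L0 : 0 < L2 by lra.
apply: (@le_trans _ _ (Num.sqrt (2 * L2) *
  (12 + (- l / L2) ^+ 2 + 8 * d ^+ 2) * Num.sqrt I)); last first.
  rewrite ler_wpM2l ?sqrt_le_max//; last lra.
  rewrite mulr_ge0 ?sqrtr_ge0//.
  by have := sqr_ge0 (- l / L2); have := sqr_ge0 d; lra.
rewrite !sqrtrM ?(ltW L0)//.
have s2 : 7 / 5 <= Num.sqrt 2 :> R.
  have -> : 7 / 5 = Num.sqrt ((7 / 5) ^+ 2) :> R by rewrite sqrtr_sqr ger0_norm//; lra.
  by apply: ler_wsqrtr; lra.
have sI : Num.sqrt Ic <= Num.sqrt I := ler_wsqrtr IcI.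
rewrite ler_pdivrMr ?exprn_gt0//.
set A := Num.sqrt L2; have A0 : 0 <= A := sqrtr_ge0 _.
set G := Num.sqrt I in sI *; set Gc := Num.sqrt Ic in sI *.
have Gc0 : 0 <= Gc := sqrtr_ge0 _.
have P0 : 0 <= 5 + (l ^+ 2 + 2 * l) by have := sqr_ge0 l; lra.
apply: (@le_trans _ _ ((5 + (l ^+ 2 + 2 * l)) * (A * G))).
  by rewrite ler_wpM2l// ler_wpM2l.
have -> : Num.sqrt 2 * A * (12 + (- l / L2) ^+ 2 + 8 * d ^+ 2) * G * L2 ^+ 2 =
  (Num.sqrt 2 * (12 * L2 ^+ 2 + l ^+ 2 + 8 * d ^+ 2 * L2 ^+ 2)) * (A * G).
  by field; rewrite gt_eqF.
have G0 : 0 <= G := le_trans Gc0 sI.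
rewrite ler_wpM2r ?(mulr_ge0 A0 G0)//.
have d0 : 0 <= 8 * d ^+ 2 * L2 ^+ 2 by rewrite mulr_ge0 ?sqr_ge0// mulr_ge0 ?sqr_ge0//.
apply: (@le_trans _ _ (7 / 5 * (12 * L2 ^+ 2 + l ^+ 2 + 8 * d ^+ 2 * L2 ^+ 2))); last first.
  by rewrite ler_wpM2r//; have := sqr_ge0 L2; have := sqr_ge0 l; lra.
have : (67 / 100) ^+ 2 <= L2 ^+ 2 by rewrite lerXn2r ?nnegrE//; lra.
(* With [ln 2 >= 67 / 100] the gap is at least [2 / 5 * (l - 5 / 2) ^+ 2] plus a positive
   constant. *)
have := sqr_ge0 (l - 5 / 2); lra.
Qed.

End Classical.

Local Open Scope complex_scope.

(** * From matrices to spectra *)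

Section Quantum.
Variable R : realType.
Local Notation C := R[i].

Lemma adjmxE m n (A : 'M[C]_(m, n)) i j : adjmx A i j = (A j i)^*.
Proof. by rewrite !mxE. Qed.

Lemma adjmxM m n p (A : 'M[C]_(m, n)) (B : 'M[C]_(n, p)) :
  adjmx (A *m B) = adjmx B *m adjmx A.
Proof. by rewrite /adjmx map_mxM trmx_mul. Qed.

Lemma adjmxK m n (A : 'M[C]_(m, n)) : adjmx (adjmx A) = A.
Proof. by apply/matrixP => i j; rewrite !mxE conjcK. Qed.

Lemma adjmxD m n (A B : 'M[C]_(m, n)) : adjmx (A + B) = adjmx A + adjmx B.
Proof. by apply/matrixP => i j; rewrite !mxE rmorphD. Qed.

Lemma adjmxN m n (A : 'M[C]_(m, n)) : adjmx (- A) = - adjmx A.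
Proof. by apply/matrixP => i j; rewrite !mxE rmorphN. Qed.

Lemma adjmxZ m n (a : C) (A : 'M[C]_(m, n)) : adjmx (a *: A) = a^* *: adjmx A.
Proof. by apply/matrixP => i j; rewrite !mxE rmorphM. Qed.

Lemma adjmx_tens m n p q (A : 'M[C]_(m, n)) (B : 'M[C]_(p, q)) :
  adjmx (A *t B) = adjmx A *t adjmx B.
Proof. by apply/matrixP => i j; rewrite !mxE rmorphM. Qed.

Lemma unitarymxC n (U : 'M[C]_n) : unitarymx U -> U *m adjmx U = 1%:M.
Proof. exact: mulmx1C. Qed.

Lemma normal_spectral n (N : 'M[C]_n) : N *m adjmx N = adjmx N *m N ->
  exists (U : 'M[C]_n) (d : 'rV[C]_n), unitarymx U /\ N = U *m diag_mx d *m adjmx U.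
Proof.
have tC m p (A : 'M[C]_(m, p)) : map_mx Num.conj A^T = adjmx A.
  by apply/matrixP => i j; rewrite !mxE.
move=> NN; have /spectral.orthomx_spectral_subproof[[P d] /= /spectral.unitarymxP PU ->] :
    N \in spectral.normalmx by apply/spectral.normalmxP; rewrite !tC.
rewrite tC in PU; have PV := mulmx1C PU.
exists (adjmx P), d; split; first by rewrite /unitarymx adjmxK.
have [_ Pu] := mulmx1_unit PV.
suff -> : invmx P = adjmx P by rewrite adjmxK.
by rewrite -[LHS]mul1mx -PV -mulmxA mulmxV// mulmx1.
Qed.

(** * Spectral decompositions and functions of matrices *)

Definition cdiag n (d : 'I_n -> R) : 'M[C]_n := diag_mx (\row_i (d i)%:C).

Definition sandwich n (U M : 'M[C]_n) : 'M[C]_n := U *m M *m adjmx U.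

(** [spectral_decomp] with the spectrum as a function on indices, the form taken by [kl] and
    [lrsq]. *)
Definition eigdec n (A U : 'M[C]_n) (d : 'I_n -> R) : Prop :=
  unitarymx U /\ A = sandwich U (cdiag d).

Lemma cdiagE n (d : 'I_n -> R) i j : cdiag d i j = (d i)%:C *+ (i == j).
Proof. by rewrite !mxE. Qed.

Lemma cdiagM n (d e : 'I_n -> R) : cdiag d *m cdiag e = cdiag (fun i => d i * e i).
Proof. by rewrite mulmx_diag; congr diag_mx; apply/rowP => i; rewrite !mxE rmorphM. Qed.

Lemma cdiagB n (d e : 'I_n -> R) : cdiag d - cdiag e = cdiag (fun i => d i - e i).
Proof. by apply/matrixP => i j; rewrite !mxE -mulrnBl rmorphB. Qed.

Lemma tr_cdiag n (d : 'I_n -> R) : \tr (cdiag d) = (\sum_i d i)%:C.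
Proof. by rewrite mxtrace_diag rmorph_sum; apply: eq_bigr => i _; rewrite mxE. Qed.

Lemma sandwichM n (U M N : 'M[C]_n) : unitarymx U ->
  sandwich U M *m sandwich U N = sandwich U (M *m N).
Proof. by move=> UU; rewrite /sandwich -!mulmxA [adjmx U *m (U *m _)]mulmxA UU mul1mx. Qed.

Lemma sandwichB n (U M N : 'M[C]_n) : sandwich U M - sandwich U N = sandwich U (M - N).
Proof. by rewrite /sandwich mulmxBr mulmxBl. Qed.

Lemma tr_sandwich n (U M : 'M[C]_n) : unitarymx U -> \tr (sandwich U M) = \tr M.
Proof. by move=> UU; rewrite /sandwich mxtrace_mulC mulmxA UU mul1mx. Qed.

Lemma adjmx_sandwich n (U M : 'M[C]_n) : adjmx (sandwich U M) = sandwich U (adjmx M).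
Proof. by rewrite /sandwich !adjmxM adjmxK mulmxA. Qed.

Lemma sandwichK n (U M : 'M[C]_n) : unitarymx U -> adjmx U *m sandwich U M *m U = M.
Proof. by move=> UU; rewrite /sandwich !mulmxA UU mul1mx -mulmxA UU mulmx1. Qed.

Lemma sandwichKV n (U M : 'M[C]_n) : unitarymx U -> sandwich U (adjmx U *m M *m U) = M.
Proof.
by move=> /unitarymxC UU; rewrite /sandwich !mulmxA UU mul1mx -mulmxA UU mulmx1.
Qed.

Lemma eigdecP n (A U : 'M[C]_n) d : eigdec A U d <->
  spectral_decomp A (U, \row_i d i).
Proof.
rewrite /eigdec /spectral_decomp /sandwich /cdiag /=.
by have -> : map_mx (fun x : R => x%:C) (\row_i d i) = \row_i (d i)%:C
  by apply/rowP => i; rewrite !mxE.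
Qed.

(** Entrywise: wherever [X i j] is nonzero, [d j = e i], hence [f (d j) = f (e i)]. *)
Lemma cdiag_intertwine (f : R -> R) n (X : 'M[C]_n) d e :
  X *m cdiag d = cdiag e *m X -> X *m cdiag (f \o d) = cdiag (f \o e) *m X.
Proof.
move=> /matrixP XD; apply/matrixP => i j; have := XD i j.
rewrite /cdiag !mul_mx_diag !mul_diag_mx !mxE /=.
have [->|x0] := eqVneq (X i j) 0; first by rewrite !mul0r !mulr0.
by rewrite mulrC => /(mulIf x0)/complexI ->; rewrite mulrC.
Qed.

(** [mxfun] takes some decomposition by choice; the overlap [X] of the two eigenbases intertwines
    the spectra, so the result does not depend on it. *)
Lemma mxfunE (f : R -> R) n (A U : 'M[C]_n) d : eigdec A U d ->
  mxfun f A = sandwich U (cdiag (f \o d)).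
Proof.
move=> Ad; rewrite /mxfun; case: pselect => [H|]; last first.
  by case; exists (U, \row_i d i); apply/eigdecP.
case: constructive_indefinite_description => -[W r] /= Wr.
have rE : r = \row_i r 0 i by apply/rowP => i; rewrite mxE.
move: Wr; rewrite rE => /eigdecP [WW AE2]; rewrite -rE.
have [UU AE] := Ad; pose e i := r 0 i.
have -> : diag_mx (map_mx (fun x => (f x)%:C) r) = cdiag (f \o e).
  by congr diag_mx; apply/rowP => i; rewrite !mxE.
pose X := adjmx W *m U.
have XD : X *m cdiag d = cdiag e *m X.
  have : adjmx W *m A *m U = adjmx W *m A *m U by [].
  rewrite {1}AE {1}AE2 /sandwich /X !mulmxA WW mul1mx.
  by rewrite -!mulmxA UU mulmx1.
have XF := cdiag_intertwine f XD.
have XU : X *m adjmx U = adjmx W by rewrite /X -mulmxA (unitarymxC UU) mulmx1.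
by rewrite -XU mulmxA -[W *m _ *m X]mulmxA -XF /X !mulmxA (unitarymxC WW) mul1mx.
Qed.

Lemma codiag n (A B : 'M[C]_n) : adjmx A = A -> adjmx B = B -> A *m B = B *m A ->
  exists U d e, eigdec A U d /\ eigdec B U e.
Proof.
(* [A + iB] is normal. *)
move=> hA hB AB; pose N := A + 'i *: B.
have aN : adjmx N = A - 'i *: B.
  rewrite /N adjmxD adjmxZ hA hB -scaleNr; congr (_ + _ *: _).
  by apply/eqP; rewrite eq_complex /= oppr0 !eqxx.
have [|U [z [UU NE]]] := @normal_spectral n N.
  rewrite aN /N !(mulmxDl, mulmxDr, mulmxN, mulNmx) -!scalemxAl -!scalemxAr AB.
  by rewrite !addrA; congr (_ - _); rewrite addrAC.
(* [N + adjmx N] is twice [A] and [N - adjmx N] is [2 'i] times [B], hence real and imaginary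
   parts. *)
exists U, (fun i => complex.Re (z 0 i)), (fun i => complex.Im (z 0 i)).
have NE2 : adjmx N = sandwich U (adjmx (diag_mx z)) by rewrite NE -adjmx_sandwich.
have two0 : (2%:R : C) != 0 by rewrite pnatr_eq0.
have i0 : ('i : C) != 0 by rewrite eq_complex /= oner_eq0 andbF.
split; split=> //.
  have E : 2%:R *: A = N + adjmx N by rewrite aN /N scaler_nat mulr2n; rewrite addrACA subrr addr0.
  apply: (scalerI two0); rewrite E NE2 [in LHS]NE -/(sandwich U (diag_mx z)) /sandwich.
  rewrite -mulmxDl -mulmxDr scalemxAl scalemxAr; congr (_ *m _ *m _).
  apply/matrixP => i j; rewrite !mxE eq_sym; have [->|_] := eqVneq j i; last first.
    by rewrite !mulr0n conjc0 mulr0 addr0.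
  rewrite !mulr1n; case: (z 0 i) => x y; apply/eqP.
  by rewrite eq_complex /=; apply/andP; split; apply/eqP; ring.
have E : (2%:R * 'i) *: B = N - adjmx N.
  by rewrite aN /N opprB addrC addrA subrK -scalerDl mulr_natl mulr2n.
apply: (scalerI (mulf_neq0 two0 i0)); rewrite E NE2 [in LHS]NE -/(sandwich U (diag_mx z)) /sandwich.
rewrite -mulmxBl -mulmxBr scalemxAl scalemxAr; congr (_ *m _ *m _).
apply/matrixP => i j; rewrite !mxE eq_sym; have [->|_] := eqVneq j i; last first.
  by rewrite !mulr0n conjc0 mulr0 subr0.
rewrite !mulr1n; case: (z 0 i) => x y; apply/eqP.
by rewrite eq_complex /=; apply/andP; split; apply/eqP; ring.
Qed.

(** * Positive semidefinite matrices *)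

Lemma quad_form_colE n (A U : 'M[C]_n) i :
  (adjmx U *m A *m U) i i = (adjmx (col i U) *m A *m col i U) 0 0.
Proof.
rewrite !mxE; apply: eq_bigr => k _; rewrite !mxE; congr (_ * _).
by apply: eq_bigr => l _; rewrite !mxE.
Qed.

Lemma psdmx_diag n (A U : 'M[C]_n) i : psdmx A -> 0 <= (adjmx U *m A *m U) i i.
Proof. by move=> pA; rewrite quad_form_colE. Qed.

(** A nonnegative complex number is real, so [A] and its adjoint have the same quadratic form. Their
    difference is normal, and its eigenvalues, being values of the difference of the forms,
    vanish. *)
Lemma psdmx_herm n (A : 'M[C]_n) : psdmx A -> adjmx A = A.
Proof.
move=> pA; pose N := A - adjmx A.
have aN : adjmx N = - N by rewrite /N adjmxD adjmxN adjmxK opprB addrC.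
have [|U [z [UU NE]]] := @normal_spectral n N; first by rewrite aN mulmxN mulNmx.
have z0 i : z 0 i = 0.
  have : (adjmx U *m N *m U) i i = z 0 i.
    by rewrite NE -/(sandwich U (diag_mx z)) sandwichK// !mxE eqxx.
  rewrite /N mulmxBr mulmxBl mxE [X in _ + X]mxE => <-.
  have pos := psdmx_diag U i pA.
  have -> : adjmx U *m adjmx A *m U = adjmx (adjmx U *m A *m U).
    by rewrite !adjmxM adjmxK mulmxA.
  rewrite adjmxE; move: pos; case: ((adjmx U *m A *m U) i i) => x y.
  rewrite lecE /= => /andP[/eqP-> _].
  by apply/eqP; rewrite eq_complex /= oppr0 !subrr eqxx.
have : N = 0.
  rewrite NE; have -> : diag_mx z = 0 by apply/matrixP => i j; rewrite !mxE z0 mul0rn.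
  by rewrite mulmx0 mul0mx.
by move/eqP; rewrite subr_eq0 => /eqP <-.
Qed.

Lemma eigdec_diag n (A U : 'M[C]_n) d : eigdec A U d ->
  forall i, (adjmx U *m A *m U) i i = (d i)%:C.
Proof. by move=> [UU ->] i; rewrite sandwichK// cdiagE eqxx. Qed.

Lemma eigdec_ge0 n (A U : 'M[C]_n) d : eigdec A U d -> psdmx A -> forall i, 0 <= d i.
Proof.
by move=> Ad pA i; have := psdmx_diag U i pA; rewrite (eigdec_diag Ad) ler0c.
Qed.

Lemma eigdec_sum n (A U : 'M[C]_n) d : eigdec A U d -> \tr A = 1 -> \sum_i d i = 1.
Proof. by move=> [UU ->]; rewrite tr_sandwich// tr_cdiag => /complexI. Qed.

Lemma full_rank_unit n (A : 'M[C]_n) : full_rank A -> A \in unitmx.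
Proof. by move=> fA; rewrite -row_free_unit -row_leq_rank fA. Qed.

Lemma eigdec_gt0 n (A U : 'M[C]_n) d : eigdec A U d -> psdmx A -> full_rank A ->
  forall i, 0 < d i.
Proof.
move=> Ad pA fA i; rewrite lt_def (eigdec_ge0 Ad pA) andbT; apply/negP => /eqP di.
have := full_rank_unit fA; rewrite unitmxE unitfE Ad.2 /sandwich !det_mulmx det_diag.
by rewrite (bigD1 i)//= mxE di !mul0r mulr0 mul0r eqxx.
Qed.

(** In a common eigenbasis the trace is a sum over the spectra; [ln 2] converts nats to bits. *)
Lemma relentE n (A B U : 'M[C]_n) d e : eigdec A U d -> eigdec B U e ->
  relent A B = kl d e / ln 2.
Proof.
move=> Ad Be; rewrite /relent /mxlog2 (mxfunE _ Ad) (mxfunE _ Be).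
have [UU ->] := Ad; rewrite sandwichB sandwichM// tr_sandwich// cdiagB cdiagM tr_cdiag /=.
by rewrite /kl mulr_suml; apply: eq_bigr => i _; rewrite /log2 /=; ring.
Qed.

Lemma relvarE n (A B U : 'M[C]_n) d e : eigdec A U d -> eigdec B U e ->
  relvar A B = lrvar d e / ln 2 ^+ 2.
Proof.
move=> Ad Be; rewrite /relvar (relentE Ad Be) /mxlog2 (mxfunE _ Ad) (mxfunE _ Be).
have [UU ->] := Ad; rewrite sandwichB !sandwichM// tr_sandwich// cdiagB !cdiagM tr_cdiag /=.
rewrite /lrvar mulrBl exprMn exprVn; congr (_ - _).
rewrite /lrsq mulr_suml; apply: eq_bigr => i _; rewrite /log2 /=.
by rewrite -exprVn; ring.
Qed.

Lemma MxE n (x : R) (A B U : 'M[C]_n) d e : eigdec A U d -> eigdec B U e -> \tr A = 1 ->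
  Mx x A B = lrsq (1 - ln x) d e / ln 2 ^+ 2.
Proof.
move=> Ad Be A1; rewrite /Mx (relvarE Ad Be) (relentE Ad Be) /log2.
rewrite lrsqE; last exact: eigdec_sum Ad A1.
by rewrite [RHS]mulrDl; congr (_ + _); rewrite -exprVn; ring.
Qed.

(** * Tensor products and partial traces *)

Definition tensfun m n (a : 'I_m -> R) (b : 'I_n -> R) (k : 'I_(m * n)) : R :=
  a (mxtens_unindex k).1 * b (mxtens_unindex k).2.

Lemma unitarymx_tens m n (U : 'M[C]_m) (W : 'M[C]_n) :
  unitarymx U -> unitarymx W -> unitarymx (U *t W).
Proof.
move=> UU WW; rewrite /unitarymx adjmx_tens tensmx_mul UU WW.
apply/matrixP => i j; case: (mxtens_indexP i) => i1 i2; case: (mxtens_indexP j) => j1 j2.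
rewrite tensmxE !mxE (can_eq (@mxtens_indexK _ _)) xpair_eqE.
by rewrite -mulnb natrM.
Qed.

Lemma cdiag_tens m n (a : 'I_m -> R) (b : 'I_n -> R) :
  cdiag a *t cdiag b = cdiag (tensfun a b).
Proof.
apply/matrixP => i j; case: (mxtens_indexP i) => i1 i2; case: (mxtens_indexP j) => j1 j2.
rewrite tensmxE !cdiagE (can_eq (@mxtens_indexK _ _)) xpair_eqE /tensfun mxtens_indexK /=.
by case: eqP; case: eqP => _ _ /=; rewrite ?mulr0n ?mul0r ?mulr0// !mulr1n rmorphM.
Qed.

Lemma eigdec_tens m n (A U : 'M[C]_m) (B W : 'M[C]_n) a b :
  eigdec A U a -> eigdec B W b -> eigdec (A *t B) (U *t W) (tensfun a b).
Proof.
move=> [UU ->] [WW ->]; split; first exact: unitarymx_tens.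
by rewrite /sandwich -cdiag_tens adjmx_tens !tensmx_mul.
Qed.

Lemma sum_mxtens (V : nmodType) m n (F : 'I_(m * n) -> V) :
  \sum_k F k = \sum_(ij : 'I_m * 'I_n) F (mxtens_index ij).
Proof.
apply: reindex; exists (@mxtens_unindex m n) => i _.
  by rewrite mxtens_indexK.
by rewrite mxtens_unindexK.
Qed.

Lemma tensfun_index m n (a : 'I_m -> R) (b : 'I_n -> R) ij :
  tensfun a b (mxtens_index ij) = a ij.1 * b ij.2.
Proof. by rewrite /tensfun mxtens_indexK. Qed.

Lemma sum_mxtens_iter (V : nmodType) m n (F : 'I_(m * n) -> V) :
  \sum_k F k = \sum_i \sum_j F (mxtens_index (i, j)).
Proof.
by rewrite sum_mxtens (pair_bigA _ (fun i j => F (mxtens_index (i, j)))); apply: eq_bigr => -[].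
Qed.

(** Partial trace is the adjoint of tensoring with the identity; with [tr_inj] this reduces the
    conjugation and cyclicity rules below to cyclicity of the trace. *)
Lemma tr_ptraceE dS dE (X : 'M[C]_(dS * dE)) (M : 'M[C]_dS) :
  \tr (ptraceE X *m M) = \tr (X *m (M *t 1%:M)).
Proof.
rewrite /mxtrace sum_mxtens_iter; apply: eq_bigr => i _; rewrite mxE.
transitivity (\sum_k \sum_j X (mxtens_index (i, k)) (mxtens_index (j, k)) * M j i).
  by rewrite exchange_big; apply: eq_bigr => j _; rewrite mxE mulr_suml.
apply: eq_bigr => k _; rewrite mxE sum_mxtens_iter; apply: eq_bigr => j _.
rewrite (bigD1 k)//= big1 ?addr0 => [|l lk]; first by rewrite tensmxE mxE eqxx mulr1.
by rewrite tensmxE mxE (negPf lk) !mulr0.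
Qed.

Lemma tr_ptraceS dS dE (X : 'M[C]_(dS * dE)) (M : 'M[C]_dE) :
  \tr (ptraceS X *m M) = \tr (X *m (1%:M *t M)).
Proof.
rewrite /mxtrace sum_mxtens_iter exchange_big /=; apply: eq_bigr => i _; rewrite mxE.
transitivity (\sum_k \sum_j X (mxtens_index (k, i)) (mxtens_index (k, j)) * M j i).
  by rewrite exchange_big; apply: eq_bigr => j _; rewrite mxE mulr_suml.
apply: eq_bigr => k _; rewrite mxE sum_mxtens_iter.
rewrite [RHS](bigD1 k)//= [X in _ + X]big1 ?addr0 => [|l lk].
  by apply: eq_bigr => j _; rewrite tensmxE mxE eqxx mul1r.
by apply: big1 => j _; rewrite tensmxE mxE (negPf lk) mul0r mulr0.
Qed.

Lemma tr_inj n (X Y : 'M[C]_n) : (forall M, \tr (X *m M) = \tr (Y *m M)) -> X = Y.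
Proof.
have E (Z : 'M[C]_n) i j : \tr (Z *m delta_mx j i) = Z i j.
  rewrite /mxtrace (bigD1 i)//= mxE (bigD1 j)//= mxE !eqxx mulr1 !big1 ?addr0// => [k ki|k kj].
    by rewrite mxE big1// => l _; rewrite mxE (negPf ki) andbF mulr0.
  by rewrite mxE (negPf kj) mulr0.
by move=> H; apply/matrixP => i j; rewrite -!E H.
Qed.

Lemma ptraceE_conj dS dE (A B : 'M[C]_dS) (Z : 'M[C]_(dS * dE)) :
  ptraceE ((A *t 1%:M) *m Z *m (B *t 1%:M)) = A *m ptraceE Z *m B.
Proof.
apply: tr_inj => M; rewrite tr_ptraceE.
have -> : \tr (A *m ptraceE Z *m B *m M) = \tr (ptraceE Z *m (B *m (M *m A))).
  by rewrite -!mulmxA mxtrace_mulC -!mulmxA.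
rewrite tr_ptraceE -!mulmxA [LHS]mxtrace_mulC -!mulmxA !tensmx_mul.
by rewrite !mulmx1.
Qed.

Lemma ptraceS_conj dS dE (A B : 'M[C]_dE) (Z : 'M[C]_(dS * dE)) :
  ptraceS ((1%:M *t A) *m Z *m (1%:M *t B)) = A *m ptraceS Z *m B.
Proof.
apply: tr_inj => M; rewrite tr_ptraceS.
have -> : \tr (A *m ptraceS Z *m B *m M) = \tr (ptraceS Z *m (B *m (M *m A))).
  by rewrite -!mulmxA mxtrace_mulC -!mulmxA.
rewrite tr_ptraceS -!mulmxA [LHS]mxtrace_mulC -!mulmxA !tensmx_mul.
by rewrite !mulmx1.
Qed.

Lemma ptraceE_cyc dS dE (A : 'M[C]_dE) (Z : 'M[C]_(dS * dE)) :
  ptraceE ((1%:M *t A) *m Z) = ptraceE (Z *m (1%:M *t A)).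
Proof.
apply: tr_inj => M; rewrite !tr_ptraceE -!mulmxA [LHS]mxtrace_mulC -!mulmxA !tensmx_mul.
by rewrite !mulmx1 !mul1mx.
Qed.

Lemma ptraceS_cyc dS dE (A : 'M[C]_dS) (Z : 'M[C]_(dS * dE)) :
  ptraceS ((A *t 1%:M) *m Z) = ptraceS (Z *m (A *t 1%:M)).
Proof.
apply: tr_inj => M; rewrite !tr_ptraceS -!mulmxA [LHS]mxtrace_mulC -!mulmxA !tensmx_mul.
by rewrite !mulmx1 !mul1mx.
Qed.

Lemma tens1mx1 m n : (1%:M : 'M[C]_m) *t (1%:M : 'M[C]_n) = 1%:M.
Proof.
by apply/matrixP => i j; case: (mxtens_indexP i) => i1 i2; case: (mxtens_indexP j) => j1 j2;
  rewrite tensmxE !mxE (can_eq (@mxtens_indexK _ _)) xpair_eqE -mulnb natrM.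
Qed.

(* By cyclicity the partial trace over [E] is invariant under conjugation by [1 (x) B^-1]. *)
Lemma ptraceE_comm dS dE (A : 'M[C]_dS) (B : 'M[C]_dE) (X : 'M[C]_(dS * dE)) :
  B \in unitmx -> X *m (A *t B) = (A *t B) *m X ->
  ptraceE X *m A = A *m ptraceE X.
Proof.
move=> uB XAB.
have -> : A *m ptraceE X = ptraceE ((A *t 1%:M) *m X).
  by rewrite -[LHS]mulmx1 -ptraceE_conj tens1mx1 mulmx1.
have -> : ptraceE X *m A = ptraceE (X *m (A *t 1%:M)).
  by rewrite -[ptraceE X]mul1mx -ptraceE_conj tens1mx1 mul1mx.
have E : A *t 1%:M = (1%:M *t invmx B) *m (A *t B).
  by rewrite tensmx_mul mul1mx (mulVmx uB).
by rewrite [in RHS]E -[in RHS]mulmxA -XAB ptraceE_cyc -[in RHS]mulmxA tensmx_mul mulmx1 (mulmxV uB).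
Qed.

Lemma ptraceS_comm dS dE (A : 'M[C]_dS) (B : 'M[C]_dE) (X : 'M[C]_(dS * dE)) :
  A \in unitmx -> X *m (A *t B) = (A *t B) *m X ->
  ptraceS X *m B = B *m ptraceS X.
Proof.
move=> uA XAB.
have -> : B *m ptraceS X = ptraceS ((1%:M *t B) *m X).
  by rewrite -[LHS]mulmx1 -ptraceS_conj tens1mx1 mulmx1.
have -> : ptraceS X *m B = ptraceS (X *m (1%:M *t B)).
  by rewrite -[ptraceS X]mul1mx -ptraceS_conj tens1mx1 mul1mx.
have E : 1%:M *t B = (invmx A *t 1%:M) *m (A *t B).
  by rewrite tensmx_mul mul1mx (mulVmx uA).
by rewrite [in RHS]E -[in RHS]mulmxA -XAB ptraceS_cyc -[in RHS]mulmxA tensmx_mul mulmx1 (mulmxV uA).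
Qed.

Lemma ptraceE_tens dS dE (A : 'M[C]_dS) (B : 'M[C]_dE) : ptraceE (A *t B) = \tr B *: A.
Proof.
apply/matrixP => i j; rewrite !mxE mulr_suml; apply: eq_bigr => k _.
by rewrite tensmxE mulrC.
Qed.

Lemma ptraceS_tens dS dE (A : 'M[C]_dS) (B : 'M[C]_dE) : ptraceS (A *t B) = \tr A *: B.
Proof.
apply/matrixP => i j; rewrite !mxE mulr_suml; apply: eq_bigr => k _.
by rewrite tensmxE.
Qed.

Lemma adjmx_ptraceE dS dE (X : 'M[C]_(dS * dE)) : adjmx (ptraceE X) = ptraceE (adjmx X).
Proof.
by apply/matrixP => i j; rewrite !mxE rmorph_sum; apply: eq_bigr => k _; rewrite !mxE.
Qed.

Lemma adjmx_ptraceS dS dE (X : 'M[C]_(dS * dE)) : adjmx (ptraceS X) = ptraceS (adjmx X).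
Proof.
by apply/matrixP => i j; rewrite !mxE rmorph_sum; apply: eq_bigr => k _; rewrite !mxE.
Qed.

(** * Outcome distributions in an orthonormal basis, and dephasing *)

Definition diagp n (W A : 'M[C]_n) j : R := complex.Re ((adjmx W *m A *m W) j j).

Lemma Re_sum (I : finType) (F : I -> C) : complex.Re (\sum_i F i) = \sum_i complex.Re (F i).
Proof. by apply: (big_morph (@complex.Re R)) => // -[? ?] []. Qed.

Lemma ReM_real (x : C) (y : R) : complex.Re (x * y%:C) = complex.Re x * y.
Proof. by case: x => a b /=; rewrite mulr0 subr0. Qed.

Lemma conj_mul_ge0 (x : C) : 0 <= complex.Re (x * x^*).
Proof. by have := mulcJ_ge0 x; rewrite lecE => /andP[]. Qed.

Lemma mul_cdiagE m n (M : 'M[C]_(m, n)) d i j : (M *m cdiag d) i j = M i j * (d j)%:C.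
Proof. by rewrite /cdiag mul_mx_diag !mxE. Qed.

Lemma relent_dephase n (A B U W : 'M[C]_n) e r : psdmx A -> eigdec A U e ->
  eigdec B W r -> kl (diagp W A) r / ln 2 <= relent A B.
Proof.
move=> pA Ae Br; have [UU AE] := Ae; have [WW BE] := Br.
have e0 := eigdec_ge0 Ae pA.
have L2 : 0 < ln 2 :> R by rewrite ln_gt0// ltr1n.
pose X := adjmx W *m U.
(* The diagonal of [A] in the basis [W] is a doubly stochastic image of its spectrum. *)
pose T j i := complex.Re (X j i * (X j i)^*).
have T0 j i : 0 <= T j i by exact: conj_mul_ge0.
have XX : adjmx X *m X = 1%:M.
  by rewrite /X adjmxM adjmxK mulmxA -[_ *m adjmx W]mulmxA (unitarymxC WW) mulmx1 UU.
have T1 i : \sum_j T j i = 1.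
  have /matrixP/(_ i i) := XX; rewrite !mxE eqxx => /(congr1 (@complex.Re R)).
  rewrite Re_sum /= => <-; apply: eq_bigr => j _; rewrite adjmxE mulrC //.
have T2 j : \sum_i T j i = 1.
  have /matrixP/(_ j j) := mulmx1C XX; rewrite !mxE eqxx => /(congr1 (@complex.Re R)).
  by rewrite Re_sum /= => <-; apply: eq_bigr => i _; rewrite adjmxE.
have NE : adjmx W *m A *m W = X *m cdiag e *m adjmx X.
  by rewrite AE /sandwich /X adjmxM adjmxK !mulmxA.
have pE j : diagp W A j = \sum_i T j i * e i.
  rewrite /diagp NE mxE Re_sum; apply: eq_bigr => i _.
  by rewrite mul_cdiagE adjmxE mulrAC ReM_real.
(* Relative to the constant weight 1, which [T] preserves as its rows also sum to 1, [kl] is minus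
   the entropy; so measuring raises the entropy. *)
have H : kl (diagp W A) (fun=> 1) <= kl e (fun=> 1).
  apply: (kl_stoch (T := T)) => // j.
  by under eq_bigr do rewrite mulr1; rewrite T2.
have kl1 (I : finType) (p : I -> R) : kl p (fun=> 1) = \sum_i p i * ln (p i).
  by apply: eq_bigr => i _; rewrite ln1 subr0.
rewrite !{}kl1 in H.
rewrite /relent /mxlog2 (mxfunE _ Ae) (mxfunE _ Br) mulmxBr raddfB /=.
have -> : \tr (A *m sandwich U (cdiag (@log2 R \o e))) = (\sum_i e i * log2 (e i))%:C.
  by rewrite AE sandwichM// tr_sandwich// cdiagM tr_cdiag.
(* The logarithm of [B] is diagonal in [W], so this term sees only the diagonal of [A] there. *)
have -> : \tr (A *m sandwich W (cdiag (@log2 R \o r))) =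
    \sum_j (adjmx W *m A *m W) j j * (log2 (r j))%:C.
  rewrite -{1}(sandwichKV A WW) sandwichM// tr_sandwich//.
  by apply: eq_bigr => j _; rewrite mul_cdiagE.
have -> : kl (diagp W A) r =
    \sum_j diagp W A j * ln (diagp W A j) - \sum_j diagp W A j * ln (r j).
  by rewrite -sumrB; apply: eq_bigr => j _; rewrite mulrBr.
set z := \sum_j _ * _%:C.
have -> : complex.Re ((\sum_i e i * log2 (e i))%:C - z) =
    (\sum_i e i * ln (e i)) / ln 2 - (\sum_j diagp W A j * ln (r j)) / ln 2.
  have -> : (\sum_j diagp W A j * ln (r j)) / ln 2 = complex.Re z.
    by rewrite /z Re_sum mulr_suml; apply: eq_bigr => j _; rewrite ReM_real mulrA.
  have -> : (\sum_i e i * ln (e i)) / ln 2 = \sum_i e i * log2 (e i).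
    by rewrite mulr_suml; apply: eq_bigr => j _; rewrite mulrA.
  by case: z => x y.
by rewrite mulrBl lerD2r ler_pM2r ?invr_gt0.
Qed.

(** * Positivity of channel outputs, and eigenvalues *)

Lemma quad_formE n (A : 'M[C]_n) (v : 'cV[C]_n) :
  (adjmx v *m A *m v) 0 0 = \sum_j \sum_i (v i 0)^* * A i j * v j 0.
Proof.
rewrite !mxE; apply: eq_bigr => j _; rewrite !mxE mulr_suml.
by apply: eq_bigr => i _; rewrite !mxE.
Qed.

Lemma psdmx_eigdec n (A U : 'M[C]_n) d : eigdec A U d -> (forall i, 0 <= d i) -> psdmx A.
Proof.
move=> [UU ->] d0 v; pose w := adjmx U *m v.
have -> : adjmx v *m sandwich U (cdiag d) *m v = adjmx w *m cdiag d *m w.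
  by rewrite /w /sandwich adjmxM adjmxK !mulmxA.
rewrite quad_formE sumr_ge0// => j _; rewrite sumr_ge0// => i _; rewrite cdiagE.
case: eqP => [->|_]; last by rewrite mulr0n mulr0 mul0r.
rewrite mulr1n mulrAC mulr_ge0 ?ler0c//.
by rewrite mulrC mulcJ_ge0.
Qed.

(** Complete positivity with a one-dimensional ancilla, after identifying ['I_(1 * n)] with
    ['I_n]. *)
Lemma channel_psdmx n (E : 'M[C]_n -> 'M[C]_n) X : channel E -> psdmx X -> psdmx (E X).
Proof.
move=> [_ cp _] pX.
have sum1 (F : 'I_(1 * n) -> C) : \sum_k F k = \sum_i F (mxtens_index (0, i)).
  by rewrite sum_mxtens_iter big_ord_recl big_ord0 addr0.
pose X1 : 'M[C]_(1 * n) := \matrix_(p, q) X (mxtens_unindex p).2 (mxtens_unindex q).2.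
have /cp pE : psdmx X1.
  move=> v; pose w : 'cV[C]_n := \col_i v (mxtens_index (0, i)) 0.
  suff -> : (adjmx v *m X1 *m v) 0 0 = (adjmx w *m X *m w) 0 0 by [].
  rewrite !quad_formE sum1; apply: eq_bigr => j _; rewrite sum1; apply: eq_bigr => i _.
  by rewrite !mxE !mxtens_indexK.
move=> w; pose v : 'cV[C]_(1 * n) := \col_k w (mxtens_unindex k).2 0.
suff -> : (adjmx w *m E X *m w) 0 0 = (adjmx v *m ampl E X1 *m v) 0 0 by [].
rewrite !quad_formE sum1; apply: eq_bigr => j _; rewrite sum1; apply: eq_bigr => i _.
rewrite !mxE !mxtens_indexK /=; congr (_ * E _ _ _ * _).
by apply/matrixP => k l; rewrite !mxE !mxtens_indexK.
Qed.

Lemma eigdec_eigenvalue n (A U : 'M[C]_n) d a : eigdec A U d ->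
  eigenvalue A a -> exists i, a = (d i)%:C.
Proof.
move=> [UU AE] /eigenvalueP[v vA v0]; pose w := v *m U.
have wD : w *m cdiag d = a *: w.
  by rewrite /w scalemxAl -vA AE /sandwich !mulmxA -[RHS]mulmxA UU mulmx1.
have /rV0Pn[j wj] : w != 0.
  apply: contraNneq v0 => w0.
  by rewrite -[v]mulmx1 -(unitarymxC UU) mulmxA -/w w0 mul0mx.
exists j; have /rowP/(_ j) := wD; rewrite mul_cdiagE [RHS]mxE => H.
by apply: (mulIf wj); rewrite -H mulrC.
Qed.

Lemma eigenvalue_eigdec n (A U : 'M[C]_n) d i : eigdec A U d -> eigenvalue A (d i)%:C.
Proof.
move=> [UU AE]; apply/eigenvalueP; exists (row i (adjmx U)).
  rewrite AE /sandwich -row_mul !mulmxA UU mul1mx row_mul.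
  have -> : row i (cdiag d) = (d i)%:C *: row i 1%:M.
    by apply/rowP => j; rewrite !mxE mulr_natr.
  by rewrite -scalemxAl -row_mul mul1mx.
apply/negP => /eqP r0; have : row i (adjmx U *m U) = 0 by rewrite row_mul r0 mul0mx.
by rewrite UU => /rowP/(_ i); rewrite !mxE eqxx => /eqP; rewrite oner_eq0.
Qed.

(* Probability of outcome [j] when measuring in the basis [W] after sending the [i]-th
   vector of the basis [V] through [E]. *)
Definition transition n (E : 'M[C]_n -> 'M[C]_n) (V W : 'M[C]_n) (j i : 'I_n) : R :=
  diagp W (E (sandwich V (delta_mx i i))) j.

(** * A channel between two bases as a stochastic matrix *)

Section Channel.
Variables (n : nat) (E : 'M[C]_n -> 'M[C]_n) (V W : 'M[C]_n).
Hypothesis cE : channel E.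
Hypothesis VV : unitarymx V.
Hypothesis WW : unitarymx W.

Lemma delta_cdiag i : delta_mx i i = cdiag (fun j => (j == i)%:R) :> 'M[C]_n.
Proof.
apply/matrixP => k l; rewrite cdiagE mxE rmorph_nat.
have [<-|kl] := eqVneq k l; first by rewrite andbb mulr1n.
rewrite mulr0n; case: (k =P i) => //= <-; by rewrite eq_sym (negPf kl).
Qed.

Lemma transition_ge0 j i : 0 <= transition E V W j i.
Proof.
have pX : psdmx (sandwich V (delta_mx i i)).
  apply: (@psdmx_eigdec _ _ V (fun k => (k == i)%:R)); last by move=> k; exact: ler0n.
  by split=> //; rewrite delta_cdiag.
by have := psdmx_diag W j (channel_psdmx cE pX); rewrite lecE => /andP[].
Qed.

Lemma transition_sum i : \sum_j transition E V W j i = 1.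
Proof.
rewrite /transition -Re_sum -/(mxtrace _) mxtrace_mulC mulmxA (unitarymxC WW) mul1mx.
have [_ _ ->] := cE; rewrite tr_sandwich// delta_cdiag tr_cdiag /=.
by rewrite (bigD1 i)//= eqxx big1 ?addr0// => j /negPf ->.
Qed.

(** By linearity: a matrix diagonal in [V] is a combination of the projections onto the columns of
    [V]. *)
Lemma transition_sum_diag d j :
  diagp W (E (sandwich V (cdiag d))) j = \sum_i transition E V W j i * d i.
Proof.
have [lin _ _] := cE.
have E0 : E 0 = 0 by have := lin (-1) 0 0; rewrite scaler0 addr0 scaleN1r addNr.
have Esum (r : seq 'I_n) (F : 'I_n -> C) (G : 'I_n -> 'M[C]_n) :
    E (\sum_(i <- r) F i *: G i) = \sum_(i <- r) F i *: E (G i).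
  by elim: r => [|i r IH]; rewrite ?big_nil// !big_cons lin IH.
have -> : sandwich V (cdiag d) = \sum_i (d i)%:C *: sandwich V (delta_mx i i).
  rewrite /sandwich; under [RHS]eq_bigr do rewrite scalemxAl scalemxAr.
  rewrite -mulmx_suml -mulmx_sumr; congr (_ *m _ *m _).
  apply/matrixP => k l; rewrite cdiagE summxE (bigD1 k)//= big1 ?addr0 => [|i ik].
    by rewrite !mxE eqxx /= eq_sym mulr_natr.
  by rewrite !mxE eq_sym (negPf ik) mulr0.
rewrite Esum /diagp mulmx_sumr mulmx_suml summxE Re_sum; apply: eq_bigr => i _.
by rewrite -scalemxAr -scalemxAl mxE mulrC ReM_real.
Qed.

End Channel.

(** [W] acts on the traced-out factor and cancels by cyclicity. *)
Lemma ptraceE_unitary dS dE (U : 'M[C]_dS) (W : 'M[C]_dE) X : unitarymx W ->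
  ptraceE (adjmx (U *t W) *m X *m (U *t W)) = adjmx U *m ptraceE X *m U.
Proof.
move=> WW; have -> : adjmx (U *t W) *m X *m (U *t W) =
    (adjmx U *t 1%:M) *m ((1%:M *t adjmx W) *m (X *m (1%:M *t W))) *m (U *t 1%:M).
  rewrite !mulmxA tensmx_mul mul1mx mulmx1 -[RHS]mulmxA tensmx_mul mul1mx mulmx1.
  by rewrite adjmx_tens.
rewrite ptraceE_conj ptraceE_cyc -[X *m _ *m _]mulmxA tensmx_mul mulmx1 (unitarymxC WW).
by rewrite tens1mx1 mulmx1.
Qed.

Lemma ptraceS_unitary dS dE (U : 'M[C]_dS) (W : 'M[C]_dE) X : unitarymx U ->
  ptraceS (adjmx (U *t W) *m X *m (U *t W)) = adjmx W *m ptraceS X *m W.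
Proof.
move=> UU; have -> : adjmx (U *t W) *m X *m (U *t W) =
    (1%:M *t adjmx W) *m ((adjmx U *t 1%:M) *m (X *m (U *t 1%:M))) *m (1%:M *t W).
  rewrite !mulmxA tensmx_mul mul1mx mulmx1 -[RHS]mulmxA tensmx_mul mul1mx mulmx1.
  by rewrite adjmx_tens.
rewrite ptraceS_conj ptraceS_cyc -[X *m _ *m _]mulmxA tensmx_mul mulmx1 (unitarymxC UU).
by rewrite tens1mx1 mulmx1.
Qed.

Lemma kl_tensfun m n (al : 'I_m -> R) (be : 'I_n -> R) (p : 'I_(m * n) -> R) :
  kl p (tensfun al be) = kl (fun ij => p (mxtens_index ij)) (fun ij => al ij.1 * be ij.2).
Proof. by rewrite /kl sum_mxtens; under eq_bigr do rewrite tensfun_index. Qed.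

Lemma lrsq_tensfun c m n (a al : 'I_m -> R) (b be : 'I_n -> R) :
  lrsq c (tensfun a b) (tensfun al be) =
  lrsq c (fun ij => a ij.1 * b ij.2) (fun ij => al ij.1 * be ij.2).
Proof. by rewrite /lrsq sum_mxtens; under eq_bigr do rewrite !tensfun_index. Qed.

(** Measuring in a product basis and forgetting the outcome on the second factor is measuring the
    partial trace in its eigenbasis [U]. *)
Lemma eigdec_ptraceE dS dE (X : 'M[C]_(dS * dE)) U W (d : 'I_dS -> R) :
  unitarymx W -> eigdec (ptraceE X) U d ->
  d =1 marg1 (fun ij => diagp (U *t W) X (mxtens_index ij)).
Proof.
move=> WW /eigdec_diag Xd x; have := Xd x; rewrite -(ptraceE_unitary _ _ WW) mxE.
by move=> /(congr1 (@complex.Re R)); rewrite Re_sum /= => <-.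
Qed.

Lemma eigdec_ptraceS dS dE (X : 'M[C]_(dS * dE)) U W (d : 'I_dE -> R) :
  unitarymx U -> eigdec (ptraceS X) W d ->
  d =1 marg2 (fun ij => diagp (U *t W) X (mxtens_index ij)).
Proof.
move=> UU /eigdec_diag Xd x; have := Xd x; rewrite -(ptraceS_unitary _ _ UU) mxE.
by move=> /(congr1 (@complex.Re R)); rewrite Re_sum /= => <-.
Qed.

End Quantum.

Theorem theorem14 (R : realType) (dS dE : nat)
  (sigS rhoS sigS' : 'M[R[i]]_dS) (sigE rhoE sigE' : 'M[R[i]]_dE)
  (E : 'M[R[i]]_(dS * dE) -> 'M[R[i]]_(dS * dE)) (smin : R) :
  state sigS -> full_rank sigS -> state sigE -> full_rank sigE ->
  state sigS' -> full_rank sigS' -> state sigE' -> full_rank sigE' ->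
  channel E ->
  E (sigS *t sigE) = sigS' *t sigE' ->
  state rhoE -> full_rank rhoE ->
  state rhoS ->
  (rhoS *t rhoE) *m (sigS *t sigE) = (sigS *t sigE) *m (rhoS *t rhoE) ->
  E (rhoS *t rhoE) *m (sigS' *t sigE') = (sigS' *t sigE') *m E (rhoS *t rhoE) ->
  min_eigenvalue (sigS *t sigE) smin ->
  let Cch := fun X : 'M[R[i]]_dS => ptraceE (E (X *t rhoE)) in
  let rhoS' := Cch rhoS in
  let rhoE' := ptraceS (E (rhoS *t rhoE)) in
  let dSS := relent rhoS sigS - relent rhoS' sigS' in
  let dSE := relent rhoE sigE - relent rhoE' sigE' in
  let dVS := relvar rhoS sigS - relvar rhoS' sigS' in
  let dVE := relvar rhoE sigE - relvar rhoE' sigE' in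
  let I := relent (E (rhoS *t rhoE)) (rhoS' *t rhoE') in
  let K := Num.sqrt (2 * ln 2) *
           (12 + log2 smin ^+ 2 + 8 * log2 (dS * dE)%:R ^+ 2) in
  let f := fun x : R => Num.max (x `^ (4%:R)^-1) (x ^+ 2) in
  dSS + dSE >=
  (dVS + dVE - K * f I) /
  (2 * Num.sqrt (Mx smin (rhoS *t rhoE) (sigS *t sigE))).
Proof.
move=> [psS tsS] fsS [psE tsE] fsE [psS' tsS'] fsS' [psE' tsE'] fsE' cE Esig.
move=> [prE trE] frE [prS trS] comm comm' [eig_smin smin_le].
cbv beta zeta; set rho' := E (rhoS *t rhoE) in comm' *.
set rhoS' := ptraceE rho'; set rhoE' := ptraceS rho'; set I := relent rho' _.
(* Tracing out the second factor, where [sigE] is invertible, turns the joint commutation into one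
   on the first; then the same with roles exchanged. *)
have cS : rhoS *m sigS = sigS *m rhoS.
  by have := ptraceE_comm (full_rank_unit fsE) comm; rewrite ptraceE_tens trE scale1r.
have cE0 : rhoE *m sigE = sigE *m rhoE.
  by have := ptraceS_comm (full_rank_unit fsS) comm; rewrite ptraceS_tens trS scale1r.
have [US [a [al [rSd sSd]]]] := codiag (psdmx_herm prS) (psdmx_herm psS) cS.
have [UE [b [be [rEd sEd]]]] := codiag (psdmx_herm prE) (psdmx_herm psE) cE0.
have rd := eigdec_tens rSd rEd; have sd := eigdec_tens sSd sEd.
have [VV rhoV] := rd; have [_ sigV] := sd.
have a0 := eigdec_ge0 rSd prS; have b0 := eigdec_ge0 rEd prE.
have a1 := eigdec_sum rSd trS; have b1 := eigdec_sum rEd trE.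
have al0 := eigdec_gt0 sSd psS fsS; have be0 := eigdec_gt0 sEd psE fsE.
have al1 := eigdec_sum sSd tsS; have be1 := eigdec_sum sEd tsE.
have pr : psdmx (rhoS *t rhoE).
  by apply: (psdmx_eigdec rd) => k; rewrite mulr_ge0.
have pr' : psdmx rho' := channel_psdmx cE pr.
have hr' := psdmx_herm pr'.
have hrS' : adjmx rhoS' = rhoS' by rewrite /rhoS' adjmx_ptraceE hr'.
have hrE' : adjmx rhoE' = rhoE' by rewrite /rhoE' adjmx_ptraceS hr'.
(* [rho'] may be correlated, but its marginals still commute with [sigS'] and [sigE'], which
   provides the product basis [W]. *)
have cS' : rhoS' *m sigS' = sigS' *m rhoS' := ptraceE_comm (full_rank_unit fsE') comm'.
have cE' : rhoE' *m sigE' = sigE' *m rhoE' := ptraceS_comm (full_rank_unit fsS') comm'.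
have [WS [a' [al' [rSd' sSd']]]] := codiag hrS' (psdmx_herm psS') cS'.
have [WE [b' [be' [rEd' sEd']]]] := codiag hrE' (psdmx_herm psE') cE'.
have sd' := eigdec_tens sSd' sEd'; have [WW _] := sd'.
have al'0 := eigdec_gt0 sSd' psS' fsS'; have be'0 := eigdec_gt0 sEd' psE' fsE'.
have al'1 := eigdec_sum sSd' tsS'; have be'1 := eigdec_sum sEd' tsE'.
pose V := US *t UE; pose W := WS *t WE.
pose p0 (i : 'I_dS * 'I_dE) := a i.1 * b i.2.
pose s0 (i : 'I_dS * 'I_dE) := al i.1 * be i.2.
pose p (i : 'I_dS * 'I_dE) := diagp W rho' (mxtens_index i).
pose s (i : 'I_dS * 'I_dE) := al' i.1 * be' i.2.
pose T (j i : 'I_dS * 'I_dE) := transition E V W (mxtens_index j) (mxtens_index i).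
have p00 i : 0 <= p0 i by rewrite mulr_ge0.
have p01 : \sum_i p0 i = 1 := prod_sum1 a1 b1.
have s00 i : 0 < s0 i by rewrite mulr_gt0.
have s01 : \sum_i s0 i = 1 := prod_sum1 al1 be1.
have sj0 i : 0 < s i by rewrite mulr_gt0.
have T0 j i : 0 <= T j i by rewrite /T transition_ge0.
have T1 i : \sum_j T j i = 1.
  by rewrite -(transition_sum cE VV WW (mxtens_index i)) sum_mxtens.
have pE j : p j = \sum_i T j i * p0 i.
  rewrite /p /rho' rhoV (transition_sum_diag _ _ cE) sum_mxtens.
  by apply: eq_bigr => i _; rewrite tensfun_index.
have sE j : s j = \sum_i T j i * s0 i.
  have -> : s j = diagp W (sigS' *t sigE') (mxtens_index j).
    by rewrite /diagp (eigdec_diag sd') /= tensfun_index.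
  rewrite -Esig sigV (transition_sum_diag _ _ cE) sum_mxtens.
  by apply: eq_bigr => i _; rewrite tensfun_index.
have m0 : 0 < smin.
  have [k /complexI ->] := eigdec_eigenvalue sd eig_smin.
  by rewrite /tensfun mulr_gt0.
have ms i : smin <= s0 i.
  by rewrite -lecR; apply: smin_le; rewrite /s0 -tensfun_index; apply: eigenvalue_eigdec sd.
have m1 : smin <= 1.
  (* Averaging [smin <= s0 i] against [p0 i <= 1] compares [smin] with the total mass of [s0]. *)
  rewrite -[leLHS]mulr1 -[in leLHS]p01 -[leRHS]s01 mulr_sumr; apply: ler_sum => i _.
  rewrite -[leRHS]mulr1; apply: ler_pM => //; first exact: ltW.
  by rewrite -p01 (bigD1 i)//= lerDl sumr_ge0.
have [M1 pmax drop] := lrvar_stoch_drop p00 p01 s00 sj0 T0 T1 sE pE m0 ms.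
pose l := - ln smin; have l0 : 0 <= l by rewrite oppr_ge0 ln_le0.
have p_ge0 i : 0 <= p i by exact: (stoch_ge0 p00 T0 pE).
have p1 : \sum_j p j = 1.
  under eq_bigr do rewrite pE.
  by rewrite exchange_big /=; under eq_bigr do rewrite -mulr_suml T1 mul1r.
have sub := lrvar_subadd p_ge0 p1 al'0 be'0 al'1 be'1 l0 pmax.
have chain := kl_chain p_ge0 al'0 be'0.
have a'E : a' = marg1 p by apply/funext; apply: (eigdec_ptraceE sEd'.1 rSd').
have b'E : b' = marg2 p by apply/funext; apply: (eigdec_ptraceS sSd'.1 rEd').
have klq0 := kl_ge0 p_ge0 p1 _ _ (prod_marg_dom p_ge0).
set klq := kl p _ in sub chain klq0.
have {}klq0 : 0 <= klq.
  apply: klq0; last exact: prod_sum1 (marg1_sum1 p1) (marg2_sum1 p1).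
  by move=> i; rewrite mulr_ge0 ?marg1_ge0 ?marg2_ge0.
have Ibound : klq / ln 2 <= I.
  (* Pairing [rho'] with itself just supplies an eigenbasis. The product of the marginals is
     diagonal in [W], so [klq] is the divergence left after dephasing. *)
  have [U [e [_ [red _]]]] := codiag hr' hr' erefl.
  have := relent_dephase pr' red (eigdec_tens rSd' rEd').
  rewrite kl_tensfun. by rewrite a'E b'E.
rewrite a'E in rSd'; rewrite b'E in rEd'.
have L := ln2_ge67 R; set L2 := ln 2 in L Ibound.
have L0 : 0 < L2 by lra.
rewrite (MxE _ rd sd); last first.
  rewrite rhoV tr_sandwich// tr_cdiag sum_mxtens.
  by under eq_bigr do rewrite tensfun_index; rewrite p01.
rewrite lrsq_tensfun -/p0 -/s0 -/L2.
set Q := lrsq _ p0 s0 in M1 drop *.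
have -> : Num.sqrt (Q / L2 ^+ 2) = Num.sqrt Q / L2.
  by rewrite sqrtrM ?(le_trans ler01)// sqrtrV ?sqr_ge0// sqrtr_sqr gtr0_norm.
have Q0 : 0 < Num.sqrt Q by rewrite sqrtr_gt0 (lt_le_trans ltr01).
rewrite ler_pdivrMr; last by rewrite mulr_gt0// divr_gt0.
have coef := coef_bound (log2 (dS * dE)%:R) l0 (divr_ge0 klq0 (ltW L0)) Ibound.
rewrite -/L2 [L2 * _]mulrC divfK ?gt_eqF// /l opprK -/l in coef.
rewrite (relentE rSd sSd) (relentE rEd sEd) (relentE rSd' sSd') (relentE rEd' sEd').
rewrite (relvarE rSd sSd) (relvarE rEd sEd) (relvarE rSd' sSd') (relvarE rEd' sEd').
have kl0 : kl p0 s0 = kl a al + kl b be := kl_prod a0 a1 b0 b1 al0 be0.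
have v0 : lrvar p0 s0 = lrvar a al + lrvar b be := lrvar_prod a0 a1 b0 b1 al0 be0.
rewrite v0 kl0 chain in drop.
(* [coef] trades [K * f I] for the correction term of [lrvar_subadd]. *)
apply: (@le_trans _ _ ((lrvar a al + lrvar b be - lrvar (marg1 p) al' - lrvar (marg2 p) be'
   - (5 + (l ^+ 2 + 2 * l)) * Num.sqrt klq) / L2 ^+ 2)).
  have -> : (lrvar a al + lrvar b be - lrvar (marg1 p) al' - lrvar (marg2 p) be'
   - (5 + (l ^+ 2 + 2 * l)) * Num.sqrt klq) / L2 ^+ 2 =
    lrvar a al / L2 ^+ 2 - lrvar (marg1 p) al' / L2 ^+ 2 +
    (lrvar b be / L2 ^+ 2 - lrvar (marg2 p) be' / L2 ^+ 2)
     - (5 + (l ^+ 2 + 2 * l)) * Num.sqrt klq / L2 ^+ 2 by ring.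
  by rewrite lerD2l lerN2.
(* By the chain rule the local drops add up to the global drop plus [klq]; the resulting extra term
   [2 * klq * sqrt Q] is nonnegative. *)
have -> : (kl a al / L2 - kl (marg1 p) al' / L2 + (kl b be / L2 - kl (marg2 p) be' / L2)) *
  (2 * (Num.sqrt Q / L2)) =
  (2 * (kl a al + kl b be - (klq + (kl (marg1 p) al' + kl (marg2 p) be'))) * Num.sqrt Q
    + 2 * klq * Num.sqrt Q) / L2 ^+ 2 by field; rewrite gt_eqF.
rewrite ler_pM2r ?invr_gt0 ?exprn_gt0//.
have : 0 <= 2 * klq * Num.sqrt Q by rewrite !mulr_ge0// ltW.
move: sub drop; rewrite -/s -/l => sub drop.
lra.
Qed.
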